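(* For all real $x,y,z$ and all real $a,b$, $$E(x,y,z)=\exp\bigl(-\mathrm{i}ax-\mathrm{i}by-\mathrm{i}z[a^2+b^2]+\mathrm{i}[a^3-3ab^2]\bigr)\sum_{n\ge0}\frac{\mathrm{i}^n}{n!}\bigl\{[z-3a]\partial_x^2+6b\,\partial_x\partial_y+[z+3a]\partial_y^2\bigr\}^nE\bigl(x+2az-3[a^2-b^2],\,y+2bz+6ab,\,0\bigr).$$
   Context: For real $x,y,z$ the elliptic umbilic integral is $$E(x,y,z)=\frac{1}{2\pi}\iint_{\mathbb{R}^2}\exp\bigl\{-\mathrm{i}(x\xi+y\eta)-\mathrm{i}z(\xi^2+\eta^2)+\mathrm{i}(\xi^3-3\xi\eta^2)\bigr\}\,\mathrm{d}\xi\,\mathrm{d}\eta ,$$ understood as an oscillatory integral, i.e. as the limit $\varepsilon\to0^+$ of the integral with the additional factor $\mathrm{e}^{-\varepsilon(\xi^2+\eta^2)}$. In the claim, $z,a,b$ are treated as constants in the differentiations with respect to $x$ and $y$. *)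

(* Defs.v *)
From mathcomp Require Export all_boot all_order all_algebra complex.
From mathcomp Require Export all_classical all_reals all_analysis.

Set Implicit Arguments.
Unset Strict Implicit.
Unset Printing Implicit Defensive.

Export GRing.Theory Num.Theory numFieldNormedType.Exports.
Global Open Scope classical_set_scope.
Global Open Scope ring_scope.
Global Open Scope complex_scope.

(* Topological notions on complex numbers are taken in [R[i]^o], which carries
   the topology of the modulus; [R[i]] itself has no topological instance. *)

Definition cexp (R : realType) (w : R[i]) : R[i] :=
  (expR (complex.Re w))%:C * (cos (complex.Im w) +i* sin (complex.Im w)).

(* Complex-valued Lebesgue integral over the plane, by components. *)
Definition cintegral2 (R : realType) (f : R * R -> R[i]) : R[i] :=
  let mu2 := (@lebesgue_measure R \x @lebesgue_measure R)%E in
  Rintegral mu2 setT (fun p => complex.Re (f p))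
  +i* Rintegral mu2 setT (fun p => complex.Im (f p)).

Definition umbilic_reg (R : realType) (x y z eps : R) : R[i]^o :=
  ((2 * pi)^-1)%:C *
  cintegral2 (fun p : R * R => let: (xi, eta) := p in
    cexp (- 'i * (x * xi + y * eta)%:C
          - 'i * (z * (xi ^+ 2 + eta ^+ 2))%:C
          + 'i * (xi ^+ 3 - 3 * xi * eta ^+ 2)%:C)
    * cexp (- (eps * (xi ^+ 2 + eta ^+ 2))%:C)).

Definition umbilicE (R : realType) (x y z : R) : R[i] :=
  lim (umbilic_reg x y z eps @[eps --> 0^'+]).

(* Derivative of a complex-valued function of a real variable, by components;
   like [derive1], it is meaningful only under [cderivable]. *)
Definition cderive (R : realType) (g : R -> R[i]) (t : R) : R[i] :=
  derive1 (fun s => complex.Re (g s)) t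
  +i* derive1 (fun s => complex.Im (g s)) t.

Definition cderivable (R : realType) (g : R -> R[i]) (t : R) : Prop :=
  derivable (fun s => complex.Re (g s)) t 1 /\
  derivable (fun s => complex.Im (g s)) t 1.

Definition dx (R : realType) (f : R -> R -> R[i]) : R -> R -> R[i] :=
  fun x y => cderive (fun s => f s y) x.

Definition dy (R : realType) (f : R -> R -> R[i]) : R -> R -> R[i] :=
  fun x y => cderive (fun s => f x s) y.

(* A word [w] of booleans encodes an iterated partial derivative, [true]
   standing for [dx] and [false] for [dy]. *)
Definition dword (R : realType) (w : seq bool) (f : R -> R -> R[i]) :
    R -> R -> R[i] :=
  foldr (fun b g => if b then dx g else dy g) f w.

Definition has_all_partials (R : realType) (f : R -> R -> R[i]) : Prop :=
  forall (w : seq bool) (x y : R),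
    cderivable (fun s => dword w f s y) x /\
    cderivable (fun s => dword w f x s) y.

Definition umbilic_op (R : realType) (z a b : R) (f : R -> R -> R[i]) :
    R -> R -> R[i] :=
  fun x y => (z - 3 * a)%:C * dx (dx f) x y
             + (6 * b)%:C * dx (dy f) x y
             + (z + 3 * a)%:C * dy (dy f) x y.

Definition umbilic_term (R : realType) (x y z a b : R) (n : nat) : R[i]^o :=
  'i ^+ n / n`!%:R *
  iter n (umbilic_op z a b) (fun u v => umbilicE u v 0)
    (x + 2 * a * z - 3 * (a ^+ 2 - b ^+ 2)) (y + 2 * b * z + 6 * a * b).

(* Main.v *)
Require Import Defs.
From mathcomp Require Import ring lra zify.
From mathcomp Require Import measurable_realfun normal_distribution.

Set Implicit Arguments.
Unset Strict Implicit.
Unset Printing Implicit Defensive.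

Import Order.TTheory.

(** Put [u = xi + i eta] and [v = xi - i eta].  Every phase that occurs has the
    form [S = a u + b v + c u^2 + d v^2 + s u v + (i/2)(u^3 + v^3)].
    Integration by parts expresses the moment of [u^(j+2) v^k] against [exp S]
    through moments of degree lower by 1, 2 and 3, so the four moments of
    [1, u, v, u v] control all others, and the moments of degree [n] grow like
    [K^n (n!)^(1/3)].  Gronwall's inequality along the regularization parameter,
    started at [eps = 1], bounds these four moments uniformly in [0 < eps <= 1].
    As differentiating a moment in a coefficient of [S] gives a moment of higher
    degree, Taylor's formula with remainder is uniform in [eps].  At order 0 it
    yields the limit [eps -> 0+], at order 1 the differentiability of the limit
    moments, and, since [(n!)^(2/3) / n! -> 0], at infinite order the
    exponential series of a quadratic perturbation of the phase.  The identity
    is that series for the quadratic part which the translation of the plane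
    by [(a, b)] brings into the phase. *)

(** At [eps = 0] the integrand has modulus 1, so nothing converges absolutely, and estimates by
    absolute values blow up as [eps -> 0]. Uniformity has to come from exact identities between
    moments, and the coordinates are chosen for these: [xi^3 - 3 xi eta^2 = (u^3 + v^3) / 2], so the
    only quadratic term in the [u]-derivative of the phase is [u^2], and in the [v]-derivative
    [v^2]. The two recursions decouple, and [1, u, v, u v] is a basis of the polynomials modulo
    [u^2] and [v^2], the local algebra of the singularity. Differentiating in [eps] multiplies by
    [u v], so the four moments lead to degree at most 4, and the recursion returns to the four: the
    differential system closes, with coefficients bounded independently of [eps]. The exponent 1/3
    arises because an integer factor enters only together with a drop of three degrees; a quadratic
    perturbation raises the degree by two per order. A last obstacle is that the translation also
    moves the damping [eps |p|^2]; the terms this leaves are of order [eps] and disappear in the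
    limit. *)

Section ComplexModulus.
Variable R : realType.
Implicit Types z w : R[i].

(** The norm of [R[i]] takes its values in [R[i]]; the estimates need it as a real number. *)
Definition cmod z : R := Num.sqrt (complex.Re z ^+ 2 + complex.Im z ^+ 2).

Lemma cmod_norm z : (cmod z)%:C = `|z|.
Proof. by rewrite normc_def. Qed.

Lemma cmodE z : cmod z = complex.Re `|z|.
Proof. by rewrite -cmod_norm. Qed.

Lemma cmod_ge0 z : 0 <= cmod z.
Proof. exact: sqrtr_ge0. Qed.

Lemma cmod0 : cmod 0 = 0.
Proof. by rewrite cmodE normr0. Qed.

Lemma cmod1 : cmod 1 = 1.
Proof. by rewrite cmodE normr1. Qed.

Lemma cmodN z : cmod (- z) = cmod z.
Proof. by rewrite !cmodE normrN. Qed.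

Lemma cmodD z w : cmod (z + w) <= cmod z + cmod w.
Proof. by rewrite -lecR rmorphD/= !cmod_norm ler_normD. Qed.

Lemma cmodB z w : cmod (z - w) <= cmod z + cmod w.
Proof. by rewrite -(cmodN w) cmodD. Qed.

Lemma cmodM z w : cmod (z * w) = cmod z * cmod w.
Proof. by apply: complexI; rewrite rmorphM/= !cmod_norm normrM. Qed.

Lemma cmodX z n : cmod (z ^+ n) = cmod z ^+ n.
Proof. by apply: complexI; rewrite rmorphXn/= !cmod_norm normrX. Qed.

Lemma cmodV z : cmod z^-1 = (cmod z)^-1.
Proof. by apply: complexI; rewrite fmorphV/= !cmod_norm normfV. Qed.

Lemma cmod_real (x : R) : cmod x%:C = `|x|.
Proof. by rewrite /cmod/= expr0n addr0 sqrtr_sqr. Qed.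

Lemma cmod_nat n : cmod n%:R = n%:R.
Proof. by rewrite cmodE normr_nat -(rmorph_nat (real_complex R)). Qed.

Lemma cmod_i : cmod 'i = 1.
Proof. by rewrite /cmod/= expr0n expr1n add0r sqrtr1. Qed.

Lemma cmodJ z : cmod (z^*)%C = cmod z.
Proof. by case: z => a b; rewrite /cmod/= sqrrN. Qed.

Lemma cmod_sqr z : cmod z ^+ 2 = complex.Re z ^+ 2 + complex.Im z ^+ 2.
Proof. by rewrite sqr_sqrtr// addr_ge0// sqr_ge0. Qed.

Lemma cmod_eq0 z : cmod z = 0 -> z = 0.
Proof. by move=> h; apply/eqP; rewrite -normr_eq0 -cmod_norm h. Qed.

Lemma ler_Re_cmod z : `|complex.Re z| <= cmod z.
Proof.
rewrite -[leLHS]sqrtr_sqr ler_sqrt ?addr_ge0 ?sqr_ge0//.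
by rewrite lerDl sqr_ge0.
Qed.

Lemma ler_Im_cmod z : `|complex.Im z| <= cmod z.
Proof.
rewrite -[leLHS]sqrtr_sqr ler_sqrt ?addr_ge0 ?sqr_ge0//.
by rewrite lerDr sqr_ge0.
Qed.

Lemma cmod_le_ReIm z : cmod z <= `|complex.Re z| + `|complex.Im z|.
Proof.
rewrite -(@ler_pXn2r _ 2)// ?nnegrE ?addr_ge0 ?cmod_ge0//.
rewrite cmod_sqr sqrrD !real_normK ?num_real//.
by rewrite lerD2r lerDl mulrn_wge0// mulr_ge0.
Qed.

Lemma ReD z w : complex.Re (z + w) = complex.Re z + complex.Re w.
Proof. by case: z; case: w. Qed.

Lemma ImD z w : complex.Im (z + w) = complex.Im z + complex.Im w.
Proof. by case: z; case: w. Qed.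

Lemma ReN z : complex.Re (- z) = - complex.Re z.
Proof. by case: z. Qed.

Lemma ImN z : complex.Im (- z) = - complex.Im z.
Proof. by case: z. Qed.

Lemma ReM z w : complex.Re (z * w) =
  complex.Re z * complex.Re w - complex.Im z * complex.Im w.
Proof. by case: z; case: w. Qed.

Lemma ImM z w : complex.Im (z * w) =
  complex.Re z * complex.Im w + complex.Im z * complex.Re w.
Proof. by case: z => a b; case: w => c d /=; rewrite (mulrC b). Qed.

Lemma ReMr (r : R) z : complex.Re (r%:C * z) = r * complex.Re z.
Proof. by rewrite ReM/= mul0r subr0. Qed.

Lemma ImMr (r : R) z : complex.Im (r%:C * z) = r * complex.Im z.
Proof. by rewrite ImM/= mul0r addr0. Qed.

Lemma cexpD z w : cexp (z + w) = cexp z * cexp w.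
Proof.
case: z => a b; case: w => c d; rewrite /cexp/= expRD cosD sinD rmorphM/=.
rewrite mulrACA; congr (_ * _).
by apply/eqP; rewrite eq_complex/= eqxx/=; apply/eqP; ring.
Qed.

Lemma cexp0 : cexp (0 : R[i]) = 1.
Proof. by rewrite /cexp/= expR0 cos0 sin0 mul1r. Qed.

Lemma cmod_cexp z : cmod (cexp z) = expR (complex.Re z).
Proof.
rewrite /cexp cmodM cmod_real ger0_norm ?expR_ge0// /cmod/=.
by rewrite cos2Dsin2 sqrtr1 mulr1.
Qed.

End ComplexModulus.

(** * Integrals over the plane dominated by a Gaussian, and their translation invariance *)

Section GaussianIntegrals.
Variable R : realType.
Local Notation mu := (@lebesgue_measure R).
Local Notation mu2 := (mu \x mu)%E.
Implicit Types (f g : R * R -> R[i]) (p : R * R).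

Definition sqnorm p : R := p.1 ^+ 2 + p.2 ^+ 2.

Definition gaussian (e : R) p : R := expR (- e * sqnorm p).

Lemma sqnorm_ge0 p : 0 <= sqnorm p.
Proof. by rewrite addr_ge0 ?sqr_ge0. Qed.

Lemma gaussian_ge0 e p : 0 <= gaussian e p.
Proof. exact: expR_ge0. Qed.

Lemma gaussian_le (e e' : R) p : e <= e' -> gaussian e' p <= gaussian e p.
Proof. by move=> ee'; rewrite ler_expR ler_wpM2r ?sqnorm_ge0// lerN2. Qed.

Lemma measurable_gaussian e : measurable_fun setT (gaussian e).
Proof.
apply: measurableT_comp => //; apply: measurable_funM => //.
by apply: measurable_funD; apply: measurable_funX.
Qed.

Lemma integrable_gaussian1 (e : R) : 0 < e ->
  mu.-integrable setT (fun x => (expR (- e * x ^+ 2))%:E).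
Proof.
(* The standard deviation for which the normal density is proportional to [exp (- e x^2)]. *)
move=> e0; pose s := Num.sqrt (2 * e)^-1.
have s2 : s ^+ 2 = (2 * e)^-1 by rewrite sqr_sqrtr// invr_ge0; lra.
have s0 : s != 0 by rewrite sqrtr_eq0 -ltNge invr_gt0; lra.
have K0 := normal_peak_gt0 s0.
have := integrableZl measurableT (normal_peak s)^-1 (integrable_normal_pdf 0 s).
apply: eq_integrable => //= x _.
rewrite -EFinM /normal_pdf (negbTE s0) mulrA mulVf ?gt_eqF// mul1r /normal_fun.
congr (expR _)%:E; rewrite subr0 s2 -mulr_natr; field.
by rewrite gt_eqF.
Qed.

Lemma integrable_gaussian (e : R) : 0 < e ->
  mu2.-integrable setT (EFin \o gaussian e).
Proof.
move=> e0; apply/integrable12ltyP.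
  by apply/measurable_EFinP; exact: measurable_gaussian.
have i1 := integrable_gaussian1 e0.
have [k ke] : exists k : R, (\int[mu]_y (expR (- e * y ^+ 2))%:E = k%:E)%E.
  exists (fine (\int[mu]_y (expR (- e * y ^+ 2))%:E)%E).
  by rewrite fineK//; exact: integrable_fin_num.
have E x : (\int[mu]_y `|(EFin \o gaussian e) (x, y)| =
    k%:E * (expR (- e * x ^+ 2))%:E)%E.
  rewrite -ke -integralZr//; apply: eq_integral => y _.
  rewrite /= /gaussian /sqnorm/= mulrDr expRD ger0_norm ?mulr_ge0 ?expR_ge0//.
  by rewrite mulrC EFinM.
under eq_integral do rewrite E.
by rewrite integralZl// ke ltry.
Qed.

Definition cmeasurable f :=
  measurable_fun setT (fun p => complex.Re (f p)) /\
  measurable_fun setT (fun p => complex.Im (f p)).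

Lemma cmeasurable_cst (c : R[i]) : cmeasurable (fun=> c).
Proof. by split. Qed.

Lemma cmeasurableD f g : cmeasurable f -> cmeasurable g ->
  cmeasurable (fun p => f p + g p).
Proof.
move=> [f1 f2] [g1 g2]; split.
- by under eq_fun do rewrite ReD; exact: measurable_funD.
- by under eq_fun do rewrite ImD; exact: measurable_funD.
Qed.

Lemma cmeasurableM f g : cmeasurable f -> cmeasurable g ->
  cmeasurable (fun p => f p * g p).
Proof.
move=> [f1 f2] [g1 g2]; split.
- by under eq_fun do rewrite ReM; apply: measurable_funB; exact: measurable_funM.
- by under eq_fun do rewrite ImM; apply: measurable_funD; exact: measurable_funM.
Qed.

Lemma cmeasurable_cexp f : cmeasurable f -> cmeasurable (fun p => cexp (f p)).
Proof.
move=> [f1 f2]; apply: cmeasurableM; split => //=.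
- exact: measurableT_comp.
- by apply: measurableT_comp f2 => //; apply: continuous_measurable_fun; exact: continuous_cos.
- by apply: measurableT_comp f2 => //; apply: continuous_measurable_fun; exact: continuous_sin.
Qed.

(** Linearity of [cintegral2] needs integrability; this criterion covers every integrand below as
    long as the damping is positive. *)
Definition gdominated f := cmeasurable f /\
  exists C e : R, 0 < e /\ forall p, cmod (f p) <= C * gaussian e p.

Lemma gdominated_integrable f : gdominated f ->
  mu2.-integrable setT (EFin \o (fun p => complex.Re (f p))) /\
  mu2.-integrable setT (EFin \o (fun p => complex.Im (f p))).
Proof.
move=> [[f1 f2] [C [e [e0 fC]]]].
have iC : mu2.-integrable setT (fun p => (C * gaussian e p)%:E).
  have := integrableZl measurableT C (integrable_gaussian e0).
  by apply: eq_integrable => //= p _; rewrite EFinM.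
split; apply: (le_integrable _ _ _ iC) => //=.
- exact/measurable_EFinP.
- move=> p _; rewrite lee_fin (le_trans (ler_Re_cmod _))//.
  by rewrite (le_trans (fC _))// ler_norm.
- exact/measurable_EFinP.
- move=> p _; rewrite lee_fin (le_trans (ler_Im_cmod _))//.
  by rewrite (le_trans (fC _))// ler_norm.
Qed.

Lemma cintegral2D f g : gdominated f -> gdominated g ->
  cintegral2 (fun p => f p + g p) = cintegral2 f + cintegral2 g.
Proof.
move=> /gdominated_integrable[f1 f2] /gdominated_integrable[g1 g2].
rewrite /cintegral2; apply/eqP; rewrite eq_complex/=.
under eq_Rintegral do rewrite ReD.
rewrite RintegralD// eqxx/=.
by under eq_Rintegral do rewrite ImD; rewrite RintegralD.
Qed.

Lemma cintegral2Z (c : R[i]) f : gdominated f ->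
  cintegral2 (fun p => c * f p) = c * cintegral2 f.
Proof.
move=> /gdominated_integrable[f1 f2].
have i (k : R) h : mu2.-integrable setT (EFin \o h) ->
    mu2.-integrable setT (EFin \o (fun p => k * h p)).
  move=> ih; have := integrableZl measurableT k ih.
  by apply: eq_integrable => //= p _; rewrite EFinM.
rewrite /cintegral2; apply/eqP; rewrite eq_complex/= ReM ImM/=.
under eq_Rintegral do rewrite ReM.
rewrite RintegralB//; [|exact: i|exact: i].
rewrite !RintegralZl// eqxx/=.
under eq_Rintegral do rewrite ImM.
by rewrite RintegralD//; [rewrite !RintegralZl|exact: i|exact: i].
Qed.

Definition gmass (e : R) : R := Rintegral mu2 setT (gaussian e).

Lemma gmass_ge0 e : 0 <= gmass e.
Proof. by apply: Rintegral_ge0 => p _; exact: gaussian_ge0. Qed.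

(** The factor 2 comes from estimating real and imaginary parts separately. *)
Lemma cmod_cintegral2 f (C e : R) : cmeasurable f -> 0 < e ->
  (forall p, cmod (f p) <= C * gaussian e p) ->
  cmod (cintegral2 f) <= 2 * C * gmass e.
Proof.
move=> mf e0 fC.
have gf : gdominated f by split => //; exists C, e.
have [i1 i2] := gdominated_integrable gf.
have iC : mu2.-integrable setT (fun p => (C * gaussian e p)%:E).
  have := integrableZl measurableT C (integrable_gaussian e0).
  by apply: eq_integrable => //= p _; rewrite EFinM.
rewrite (le_trans (cmod_le_ReIm _))//=.
rewrite -mulrA mulrDl mul1r lerD// (le_trans (le_normr_Rintegral _ _))//.
- rewrite /gmass -RintegralZl//; last exact: integrable_gaussian.
  apply: le_Rintegral => //=.
    by have := integrable_abse i1; apply: eq_integrable.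
  by move=> p _; rewrite (le_trans (ler_Re_cmod _)).
- rewrite /gmass -RintegralZl//; last exact: integrable_gaussian.
  apply: le_Rintegral => //=.
    by have := integrable_abse i2; apply: eq_integrable.
  by move=> p _; rewrite (le_trans (ler_Im_cmod _)).
Qed.

(** By uniqueness: the translated measure gives half-open intervals their length. *)
Lemma lebesgue_measure_translation (a : R) (A : set R) : measurable A ->
  pushforward mu (fun x : R => x + a : measurableTypeR R) A = mu A.
Proof.
have mt : measurable_fun setT (fun x : R => x + a : measurableTypeR R).
  exact: measurable_funD.
move=> mA; apply/esym/lebesgue_measure_unique => //= _ [[x y]] _ <-.
rewrite /pushforward (_ : _ @^-1` _ = `]x - a, y - a]%classic).
  by rewrite !lebesgue_measure_itv/= !lte_fin ltrD2r -!EFinB opprB addrA subrK.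
by apply/seteqP; split => z/=; rewrite !in_itv/= ltrBlDr lerBrDr.
Qed.

(** Invariance of the product measure is checked on rectangles. The lemma serves twice:
    differentiated at the identity it gives integration by parts, and it performs the final shift by
    [(a, b)]. *)
Lemma cintegral2_translation f (a b : R) : gdominated f ->
  cintegral2 (fun p => f (p.1 + a, p.2 + b)) = cintegral2 f.
Proof.
move=> gf; have [i1 i2] := gdominated_integrable gf.
pose phi p : measurableTypeR R * measurableTypeR R := (p.1 + a, p.2 + b).
have mphi : measurable_fun setT phi.
  by apply/measurable_fun_pairP; split => /=; apply: measurable_funD.
suff tr (h : R * R -> R) : mu2.-integrable setT (EFin \o h) ->
    Rintegral mu2 setT (fun p => h (p.1 + a, p.2 + b)) = Rintegral mu2 setT h.
  by rewrite /cintegral2 (tr (fun p => complex.Re (f p)))// (tr (fun p => complex.Im (f p))).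
move=> ih; rewrite /Rintegral; congr fine.
have mh : measurable_fun setT (EFin \o h) by exact: measurable_int ih.
have E A : measurable A -> pushforward mu2 phi A = mu2 A.
  move=> mA; apply/esym/product_measure_unique => //= X Y mX mY.
  rewrite /pushforward (_ : phi @^-1` (X `*` Y) =
    ((fun x => x + a) @^-1` X) `*` ((fun x => x + b) @^-1` Y))//.
  have mt c Z : measurable Z -> measurable ((fun x : R => x + c) @^-1` Z).
    by move=> mZ; rewrite -[X in measurable X]setTI; exact: measurable_funD.
  rewrite [LHS]product_measure1E//; [|exact: mt|exact: mt].
  by congr (_ * _)%E; exact: lebesgue_measure_translation.
have pE (F : R * R -> \bar R) :
    (\int[pushforward mu2 phi]_p F p = \int[mu2]_p F p)%E.
  by apply: eq_measure_integral => A mA _; exact: E.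
rewrite -[RHS]pE integral_pushforward//=.
apply/integrableP; split; first exact: (measurableT_comp mh mphi).
have /integrableP[_] := ih.
rewrite -pE ge0_integral_pushforward//; exact: measurableT_comp.
Qed.

End GaussianIntegrals.

(** * Real calculus: derivatives, Taylor's formula, Gronwall's inequality *)

Section RealCalculus.
Variable R : realType.

(** All derivatives of moments are obtained through explicit quadratic remainders, and this turns
    such a remainder into a derivative. *)
Lemma is_derive_quadratic (g : R -> R) (t l B d : R) : 0 < d ->
  (forall h, `|h| <= d -> `|g (t + h) - g t - h * l| <= B * h ^+ 2) ->
  is_derive t 1 g l.
Proof.
move=> d0 gB.
have B0 : 0 <= B.
  have := gB d; rewrite (ger0_norm (ltW d0)) => /(_ (lexx _)) h.
  have := le_trans (normr_ge0 _) h; rewrite pmulr_lge0// exprn_gt0//.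
have H : h^-1 *: ((g \o shift t) (h *: 1) - g t) @[h --> (0:R)^'] --> l.
  apply/cvgrPdist_le => e e0; near=> h.
  have h0 : h != 0 by near: h; exact: nbhs_dnbhs_neq.
  have hd : `|h| < Num.min d (e / (B + 1)).
    near: h; apply: dnbhs0_lt; rewrite lt_min d0 divr_gt0//; lra.
  rewrite /= /shift/= [_ *: 1]mulr1 (addrC h t).
  rewrite -[_ *: _]/(_ * _).
  have -> : l - h^-1 * (g (t + h) - g t) = - (h^-1 * (g (t + h) - g t - h * l)).
    by field.
  rewrite normrN normrM normfV.
  move: hd; rewrite lt_min => /andP[/ltW hd he].
  have nh : 0 < `|h| by rewrite normr_gt0.
  rewrite ler_pdivrMl// (le_trans (gB h hd))//.
  rewrite -(real_normK (num_real h)) expr2 mulrA mulrC ler_pM2l//.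
  move: he; rewrite ltr_pdivlMr; last lra.
  by move=> he; nra.
apply: DeriveDef; first by apply: cvgP H.
exact: cvg_lim H.
Unshelve. all: by end_near. Qed.

Lemma der_eq (t : R) (f : R -> R) (df df' : R) : is_derive t 1 f df ->
  df = df' -> is_derive t 1 f df'.
Proof. by move=> h <-. Qed.

Lemma der_cst (t c : R) : is_derive t 1 (fun=> c) (0 : R).
Proof. exact: is_derive_cst. Qed.

Lemma der_lin (t c : R) : is_derive t 1 (fun s => c * s) (c : R).
Proof.
have h := is_deriveZ c (is_derive_id t 1).
by apply: is_derive_eq h _; rewrite /GRing.scale/= mulr1.
Qed.

Lemma derD (t : R) (f g : R -> R) (df dg : R) :
  is_derive t 1 f df -> is_derive t 1 g dg ->
  is_derive t 1 (fun s => f s + g s) (df + dg).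
Proof. by move=> hf hg; exact: is_deriveD hf hg. Qed.

Lemma derM (t : R) (f g : R -> R) (df dg : R) :
  is_derive t 1 f df -> is_derive t 1 g dg ->
  is_derive t 1 (fun s => f s * g s) (df * g t + f t * dg).
Proof.
move=> hf hg; have h := is_deriveM hf hg.
by apply: is_derive_eq h _; rewrite /GRing.scale/= addrC (mulrC (g t)).
Qed.

Lemma derZ (t c : R) (f : R -> R) (df : R) :
  is_derive t 1 f df -> is_derive t 1 (fun s => c * f s) (c * df).
Proof.
by move=> hf; apply: der_eq (derM (der_cst t c) hf) _; rewrite mul0r add0r.
Qed.

Lemma derX (t : R) (n : nat) (f : R -> R) (df : R) :
  is_derive t 1 f df ->
  is_derive t 1 (fun s => f s ^+ n) (n%:R * f t ^+ n.-1 * df).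
Proof.
move=> hf; elim: n => [|n IH].
  by rewrite !mul0r; under [X in is_derive _ _ X]eq_fun do rewrite expr0;
     exact: der_cst.
under [X in is_derive _ _ X]eq_fun do rewrite exprS.
apply: der_eq (derM hf IH) _; case: n {IH} => [|n] /=.
  by rewrite !expr0; ring.
by rewrite exprS -[in RHS]natr1; ring.
Qed.

Lemma der_sum (t : R) (I : Type) (r : seq I) (f : I -> R -> R) (df : I -> R) :
  (forall i, is_derive t 1 (f i) (df i)) ->
  is_derive t 1 (fun s => \sum_(i <- r) f i s) (\sum_(i <- r) df i).
Proof.
move=> hf; elim: r => [|i r IH].
  rewrite big_nil; under [X in is_derive _ _ X]eq_fun do rewrite big_nil.
  exact: der_cst.
rewrite big_cons; under [X in is_derive _ _ X]eq_fun do rewrite big_cons.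
exact: derD.
Qed.

Lemma der_expR (t : R) (f : R -> R) (df : R) : is_derive t 1 f df ->
  is_derive t 1 (fun s => expR (f s)) (expR (f t) * df).
Proof. by move=> hf; exact: is_derive1_comp (is_derive_expR _) hf. Qed.

Lemma der_cos (t : R) (f : R -> R) (df : R) : is_derive t 1 f df ->
  is_derive t 1 (fun s => cos (f s)) (- sin (f t) * df).
Proof. by move=> hf; exact: is_derive1_comp (is_derive_cos _) hf. Qed.

Lemma der_sin (t : R) (f : R -> R) (df : R) : is_derive t 1 f df ->
  is_derive t 1 (fun s => sin (f s)) (cos (f t) * df).
Proof. by move=> hf; exact: is_derive1_comp (is_derive_sin _) hf. Qed.

Lemma mvt_bound (f df : R -> R) (M : R) :
  (forall t : R, 0 <= t <= 1 -> is_derive t 1 f (df t)) ->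
  (forall t : R, 0 <= t <= 1 -> `|df t| <= M) -> `|f 1 - f 0| <= M.
Proof.
move=> fd dM.
have [||c] := @MVT R f df 0 1 ltr01.
- by move=> t; rewrite in_itv/= => /andP[/ltW t0 /ltW t1]; apply: fd; rewrite t0.
- apply: derivable_within_continuous => t; rewrite in_itv/= => t01.
  by have := fd t t01; case.
rewrite in_itv/= => /andP[/ltW c0 /ltW c1] ->.
by rewrite subr0 mulr1 dM// c0.
Qed.

(** The derivative of [psi n], the Taylor polynomial at [t] evaluated at 1, telescopes to
    [f n.+1 t * (1 - t) ^+ n / n!]. The mean value theorem then gives [1 / n!] instead of
    [1 / (n + 1)!], which suffices. *)
Lemma taylor_real (f : nat -> R -> R) (n : nat) (M : R) :
  (forall m (t : R), 0 <= t <= 1 -> is_derive t 1 (f m) (f m.+1 t)) ->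
  (forall t : R, 0 <= t <= 1 -> `|f n.+1 t| <= M) ->
  `|f 0%N 1 - \sum_(m < n.+1) f m 0 / m`!%:R| <= M / n`!%:R.
Proof.
move=> fd fM.
pose psi n t := \sum_(m < n.+1) f m t * (1 - t) ^+ m / m`!%:R.
have -> : f 0%N 1 = psi n 1.
  rewrite /psi big_ord_recl/= expr0 fact0 divr1 mulr1 big1 ?addr0// => i _.
  by rewrite subrr exprS mul0r mulr0 mul0r.
have -> : \sum_(m < n.+1) f m 0 / m`!%:R = psi n 0.
  by apply: eq_bigr => i _; rewrite subr0 expr1n mulr1.
apply: (@mvt_bound _ (fun t => f n.+1 t * (1 - t) ^+ n / n`!%:R)) => t t01.
  elim: n {fM} => [|n IH].
    rewrite expr0 fact0 divr1 mulr1.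
    have -> : psi 0%N = f 0%N.
      by apply/funext => s; rewrite /psi big_ord1 expr0 fact0 divr1 mulr1.
    exact: fd.
  have d1 := fd n.+1 t t01.
  have d2 : is_derive t 1 (fun s : R => 1 + (-1) * s) (-1).
    by apply: der_eq (derD (der_cst _ _) (der_lin _ _)) _; rewrite add0r.
  have d4 := derM (derM d1 (derX n.+1 d2)) (der_cst t (n.+1`!%:R)^-1).
  have E : psi n.+1 =
      (fun s => psi n s + f n.+1 s * (1 + -1 * s) ^+ n.+1 / n.+1`!%:R).
    by apply/funext => s; rewrite /psi big_ord_recr/= mulN1r.
  rewrite E; apply: der_eq (derD IH d4) _.
  rewrite factS natrM !mulN1r.
  have n0 : (n`!%:R : R) != 0 by rewrite pnatr_eq0 -lt0n fact_gt0.
  by rewrite /=; field; rewrite n0/= addrC natr1 pnatr_eq0.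
have /andP[t0 t1] := t01.
rewrite normrM normrM [X in _ * X](_ : _ = n`!%:R^-1); last by rewrite ger0_norm.
rewrite ler_pM2r ?invr_gt0 ?ltr0n ?fact_gt0//.
rewrite (le_trans _ (fM t t01))// ler_piMr// normrX exprn_ile1//.
by rewrite ger0_norm; lra.
Qed.

(** Cauchy-Schwarz against the constant vector, through [2 |s t| <= s^2 + t^2] on each pair. *)
Lemma sum_norm_sqr_le (I : finType) (x : I -> R) :
  (\sum_i `|x i|) ^+ 2 <= #|I|%:R * \sum_i x i ^+ 2.
Proof.
have -> : #|I|%:R * \sum_i x i ^+ 2 = \sum_i \sum_j (x i ^+ 2 + x j ^+ 2) / 2.
  have E i : \sum_j (x i ^+ 2 + x j ^+ 2) / 2 =
      (#|I|%:R * x i ^+ 2 + \sum_j x j ^+ 2) / 2.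
    by rewrite -mulr_suml big_split/= sumr_const mulr_natl.
  rewrite (eq_bigr _ (fun i _ => E i)) -mulr_suml big_split/=.
  rewrite -mulr_sumr sumr_const -[X in (_ + X) / _]mulr_natl.
  by field.
rewrite expr2 mulr_suml; apply: ler_sum => i _; rewrite mulr_sumr.
apply: ler_sum => j _.
rewrite -(real_normK (num_real (x i))) -(real_normK (num_real (x j))).
have := sqr_ge0 (`|x i| - `|x j|); rewrite sqrrB; nra.
Qed.

(** The sum of squares is used because it is differentiable where the sum of absolute values need
    not be. Its derivative is at most [2 K] times the squared sum of the [|f i|], hence at most [c]
    times itself, so [expR (- c * t) * g t] does not increase. *)
Lemma gronwall (I : finType) (f df : I -> R -> R) (K : R) : 0 <= K ->
  (forall i (t : R), 0 <= t <= 1 -> is_derive t 1 (f i) (df i t)) ->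
  (forall i (t : R), 0 <= t <= 1 -> `|df i t| <= K * \sum_j `|f j t|) ->
  \sum_i f i 1 ^+ 2 <= expR (2 * K * #|I|%:R) * \sum_i f i 0 ^+ 2.
Proof.
move=> K0 fd dK; set c := 2 * K * #|I|%:R.
pose g t := \sum_i f i t ^+ 2.
pose g' t := \sum_i 2 * f i t * df i t.
have gd (t : R) : 0 <= t <= 1 -> is_derive t 1 g (g' t).
  move=> t01; rewrite /g /g'.
  apply: der_sum => i; apply: der_eq (derX 2 (fd i t t01)) _.
  by rewrite expr1.
have g'le (t : R) : 0 <= t <= 1 -> g' t <= c * g t.
  move=> t01; apply: (@le_trans _ _ (2 * K * (\sum_i `|f i t|) ^+ 2)).
    rewrite expr2 mulrA mulr_sumr; apply: ler_sum => i _.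
    rewrite (le_trans (ler_norm _))// !normrM (ger0_norm (ler0n _ _)).
    have := ler_wpM2l (normr_ge0 (f i t)) (dK i t t01); lra.
  rewrite /c -!mulrA ler_pM2l// ler_wpM2l//.
  exact: sum_norm_sqr_le.
have hd (t : R) : 0 <= t <= 1 ->
    is_derive t 1 (fun s => expR (- c * s) * g s) (expR (- c * t) * (g' t - c * g t)).
  move=> t01.
  apply: der_eq (derM (der_expR (der_lin _ _)) (gd t t01)) _; ring.
have [||x] := @MVT R (fun s => expR (- c * s) * g s)
    (fun t => expR (- c * t) * (g' t - c * g t)) 0 1 ltr01.
- by move=> t; rewrite in_itv/= => /andP[/ltW t0 /ltW t1]; apply: hd; rewrite t0.
- apply: derivable_within_continuous => t; rewrite in_itv/= => t01.
  by have := hd t t01; case.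
rewrite in_itv/= => /andP[/ltW x0 /ltW x1] E.
have : expR (- c * 1) * g 1 <= expR (- c * 0) * g 0.
  rewrite -subr_le0 E subr0 mulr1 mulr_ge0_le0 ?expR_ge0// subr_le0 g'le//.
  by rewrite x0.
by rewrite mulr0 expR0 mul1r mulr1 expRN ler_pdivrMl ?expR_gt0.
Qed.

(** Every [f s - C * s] lies below every [f t + C * t]; the supremum of the former separates the two
    families and is the limit at 0, with a linear rate. *)
Lemma lipschitz_limit0 (f : R -> R) (C : R) :
  (forall s t : R, 0 < s <= 1 -> 0 < t <= 1 -> `|f s - f t| <= C * `|s - t|) ->
  exists l, forall s : R, 0 < s <= 1 -> `|f s - l| <= C * s.
Proof.
move=> fC.
have C0 : 0 <= C.
  have := fC 1 2^-1; rewrite lexx ltr01 /= => /(_ isT).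
  have -> : 0 < (2^-1 : R) <= 1 by lra.
  move=> /(_ isT) h; have := le_trans (normr_ge0 _) h.
  by rewrite pmulr_lge0// normr_gt0; lra.
pose A := [set f s - C * s | s in [set s | 0 < s <= 1]].
have ub s : 0 < s <= 1 -> ubound A (f s + C * s).
  move=> s01 _ [t t01 <-]; have := fC t s t01 s01.
  rewrite ler_norml => /andP[_ h].
  have : `|t - s| <= t + s by case/andP: s01 => ? _; case/andP: t01 => ? _; rewrite ler_norml; lra.
  move=> /(ler_wpM2l C0); lra.
have A1 : A (f 1 - C * 1) by exists 1 => //=; rewrite ltr01 lexx.
have hs : has_sup A.
  split; first by exists (f 1 - C * 1).
  by exists (f 1 + C * 1); apply: ub; rewrite ltr01 lexx.
exists (sup A) => s s01; rewrite ler_distl; apply/andP; split.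
  rewrite lerBlDr; apply: ge_sup; first by exists (f 1 - C * 1).
  exact: ub.
by rewrite -lerBlDr; apply: ub_le_sup; [case: hs|exists s].
Qed.

End RealCalculus.

(** * Calculus for complex-valued functions of a real variable *)

Section ComplexCalculus.
Variable R : realType.

Definition is_cderive (g : R -> R[i]) (t : R) (l : R[i]) :=
  is_derive t 1 (fun s => complex.Re (g s)) (complex.Re l) /\
  is_derive t 1 (fun s => complex.Im (g s)) (complex.Im l).

Lemma is_cderive_quadratic (g : R -> R[i]) (t : R) (l : R[i]) (B d : R) : 0 < d ->
  (forall h : R, `|h| <= d -> cmod (g (t + h) - g t - h%:C * l) <= B * h ^+ 2) ->
  is_cderive g t l.
Proof.
move=> d0 gB; split; apply: (is_derive_quadratic (B := B) d0) => h /gB.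
  apply: le_trans; apply: le_trans (ler_Re_cmod _).
  by rewrite !(ReD, ReN) ReMr.
apply: le_trans; apply: le_trans (ler_Im_cmod _).
by rewrite !(ImD, ImN) ImMr.
Qed.

Lemma taylor_complex (f : nat -> R -> R[i]) (n : nat) (M : R) :
  (forall m (t : R), 0 <= t <= 1 -> is_cderive (f m) t (f m.+1 t)) ->
  (forall t : R, 0 <= t <= 1 -> cmod (f n.+1 t) <= M) ->
  cmod (f 0%N 1 - \sum_(m < n.+1) f m 0 / m`!%:R) <= 2 * M / n`!%:R.
Proof.
move=> fd fM.
have fE m : (m`!%:R : R[i])^-1 = (m`!%:R^-1 : R)%:C.
  by rewrite fmorphV/= rmorph_nat.
rewrite (le_trans (cmod_le_ReIm _))// -mulrA mulrDl mul1r lerD//.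
- have := @taylor_real R (fun m t => complex.Re (f m t)) n M.
  rewrite ReD ReN (big_morph (@complex.Re R) (@ReD R) (erefl _)).
  under [in X in _ -> X]eq_bigr do rewrite fE mulrC ReMr mulrC.
  apply; first by move=> m t /(fd m)[].
  by move=> t /fM; apply: le_trans; exact: ler_Re_cmod.
- have := @taylor_real R (fun m t => complex.Im (f m t)) n M.
  rewrite ImD ImN (big_morph (@complex.Im R) (@ImD R) (erefl _)).
  under [in X in _ -> X]eq_bigr do rewrite fE mulrC ImMr mulrC.
  apply; first by move=> m t /(fd m)[].
  by move=> t /fM; apply: le_trans; exact: ler_Im_cmod.
Qed.

Lemma is_cderive_cexp (w z : R[i]) (t : R) :
  is_cderive (fun s => w * cexp (s%:C * z)) t (w * z * cexp (t%:C * z)).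
Proof.
case: w => wr wi; case: z => a b.
have dE := der_expR (der_lin t a).
have dC := der_cos (der_lin t b).
have dS := der_sin (der_lin t b).
have E s : cexp (s%:C * (a +i* b)) =
    (expR (a * s) * cos (b * s)) +i* (expR (a * s) * sin (b * s)).
  by rewrite /cexp ReMr ImMr/= !(mulrC s); apply/eqP; rewrite eq_complex ReMr ImMr/= !eqxx.
split.
- under [X in is_derive _ _ X]eq_fun do rewrite E ReM/= -mulNr.
  rewrite E !(ReM, ImM)/=.
  apply: der_eq (derD (derZ wr (derM dE dC)) (derZ (- wi) (derM dE dS))) _ => //.
  ring.
- under [X in is_derive _ _ X]eq_fun do rewrite E ImM/=.
  rewrite E !(ReM, ImM)/=.
  apply: der_eq (derD (derZ wr (derM dE dS)) (derZ wi (derM dE dC))) _ => //.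
  ring.
Qed.

(** Taylor's formula of order 1 for [t |-> cexp (t z)] between 0 and 1. *)
Lemma cexp_quadratic (z : R[i]) :
  cmod (cexp z - 1 - z) <= 2 * (cmod z ^+ 2 * expR (cmod z)).
Proof.
have := @taylor_complex (fun n t => z ^+ n * cexp (t%:C * z)) 1
  (cmod z ^+ 2 * expR (cmod z)).
rewrite !big_ord_recl big_ord0 /= rmorph0 rmorph1 mul0r cexp0.
rewrite !(divr1, mulr1, mul1r, expr0, expr1, addr0, fact0, invr1) opprD addrA.
apply=> [m t _|t /andP[t0 t1]].
  by have := is_cderive_cexp (z ^+ m) z t; rewrite exprSr.
rewrite cmodM cmodX cmod_cexp ReMr ler_wpM2l ?exprn_ge0 ?cmod_ge0// ler_expR.
rewrite (le_trans (ler_norm _))// normrM (ger0_norm t0).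
rewrite (le_trans _ (ler_Re_cmod z))// ler_piMl//.
Qed.

End ComplexCalculus.

(** * Functions of polynomial growth; the coordinates [zeta] and [zetab] *)

Section Tempered.
Variable R : realType.
Implicit Types (f g : R * R -> R[i]) (p : R * R).

Definition tempered f := cmeasurable f /\
  exists (C : R) (n : nat), forall p, cmod (f p) <= C * (1 + sqnorm p) ^+ n.

Lemma sqnorm1_ge1 p : 1 <= 1 + sqnorm p.
Proof. by rewrite lerDl sqnorm_ge0. Qed.

Lemma sqnorm1_ge0 p : 0 <= 1 + sqnorm p.
Proof. by rewrite (le_trans ler01) ?sqnorm1_ge1. Qed.

(** As [1 + sqnorm p >= 1], the exponent may be raised; bounds for two functions can thus be brought
    to a common exponent. *)
Lemma tempered_exp f : tempered f -> exists C n, 0 <= C /\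
  forall m p, (n <= m)%N -> cmod (f p) <= C * (1 + sqnorm p) ^+ m.
Proof.
move=> [_ [C [n fC]]]; exists `|C|, n; split => // m p nm.
rewrite (le_trans (fC p))// (@le_trans _ _ (`|C| * (1 + sqnorm p) ^+ n))//.
  by rewrite ler_wpM2r ?ler_norm// exprn_ge0// sqnorm1_ge0.
by rewrite ler_wpM2l// ler_weXn2l// sqnorm1_ge1.
Qed.

Lemma tempered_cst (c : R[i]) : tempered (fun=> c).
Proof.
split; first exact: cmeasurable_cst.
by exists (cmod c), 0%N => p; rewrite expr0 mulr1.
Qed.

Lemma temperedD f g : tempered f -> tempered g -> tempered (fun p => f p + g p).
Proof.
move=> tf tg; split; first by apply: cmeasurableD; [case: tf|case: tg].
have [C [n [C0 fC]]] := tempered_exp tf; have [D [m [D0 gD]]] := tempered_exp tg.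
exists (C + D), (n + m)%N => p; rewrite (le_trans (cmodD _ _))// mulrDl.
by rewrite lerD ?fC ?gD ?leq_addr ?leq_addl.
Qed.

Lemma temperedM f g : tempered f -> tempered g -> tempered (fun p => f p * g p).
Proof.
move=> tf tg; split; first by apply: cmeasurableM; [case: tf|case: tg].
have [C [n [C0 fC]]] := tempered_exp tf; have [D [m [D0 gD]]] := tempered_exp tg.
exists (C * D), (n + m)%N => p; rewrite cmodM exprD mulrACA.
by apply: ler_pM; rewrite ?cmod_ge0// ?fC ?gD.
Qed.

Lemma temperedX f n : tempered f -> tempered (fun p => f p ^+ n).
Proof.
move=> tf; elim: n => [|n IH].
  by under eq_fun do rewrite expr0; exact: tempered_cst.
by under eq_fun do rewrite exprS; exact: temperedM.
Qed.

(** [zeta] and [zetab] are the coordinates [u] and [v] of the overview. *)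
Definition zeta p : R[i] := p.1 +i* p.2.
Definition zetab p : R[i] := p.1 -i* p.2.

Lemma sqnorm_zeta p : (sqnorm p)%:C = zeta p * zetab p.
Proof.
by apply/eqP; rewrite eq_complex ReM ImM/=; apply/andP; split; apply/eqP;
   rewrite /sqnorm; ring.
Qed.

Lemma cmod_zeta p : cmod (zeta p) ^+ 2 = sqnorm p.
Proof. by rewrite cmod_sqr. Qed.

Lemma cmod_zetab p : cmod (zetab p) = cmod (zeta p).
Proof. by rewrite /cmod/= sqrrN. Qed.

Lemma cmod_zeta_le p : cmod (zeta p) <= 1 + sqnorm p.
Proof. by rewrite -cmod_zeta; have := sqr_ge0 (cmod (zeta p) - 1); nra. Qed.

Lemma tempered_zeta : tempered zeta.
Proof.
split; first by split; [exact: measurable_fst|exact: measurable_snd].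
by exists 1, 1%N => p; rewrite mul1r expr1 cmod_zeta_le.
Qed.

Lemma tempered_zetab : tempered zetab.
Proof.
split.
  by split; [exact: measurable_fst|apply: measurableT_comp => //; exact: measurable_snd].
by exists 1, 1%N => p; rewrite mul1r expr1 cmod_zetab cmod_zeta_le.
Qed.

Lemma exprn_le_expR (n : nat) (d : R) : 0 < d ->
  exists C, 0 <= C /\ forall x : R, 0 <= x -> (1 + x) ^+ n <= C * expR (d * x).
Proof.
elim: n d => [|n IH] d d0.
  exists 1; split => // x x0; rewrite expr0 mul1r.
  by rewrite (le_trans _ (expR_ge1Dx _))// lerDl mulr_ge0// ltW.
(* Half of the rate pays for one factor [1 + x], the other half for the remaining [n]. *)
have d2 : 0 < d / 2 by rewrite divr_gt0.
have [C [C0 hC]] := IH _ d2.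
exists ((1 + (d / 2)^-1) * C); split => [|x x0].
  by rewrite mulr_ge0// addr_ge0// invr_ge0 ltW.
rewrite exprS.
have -> : d * x = d / 2 * x + d / 2 * x by field.
rewrite expRD (_ : _ * C * _ = (1 + (d / 2)^-1) * expR (d / 2 * x) *
  (C * expR (d / 2 * x))); last by ring.
apply: ler_pM => //; [by rewrite addr_ge0|by rewrite exprn_ge0// addr_ge0| |exact: hC].
have e := expR_ge1Dx (d / 2 * x).
have dx : 0 <= d / 2 * x by rewrite mulr_ge0// ltW.
rewrite mulrDl mul1r lerD//; first lra.
rewrite ler_pdivlMl//; lra.
Qed.

End Tempered.

(** * Integrals with a damped phase, and differentiation under the integral sign *)

Section Oscillatory.
Variable R : realType.
Implicit Types (f g S : R * R -> R[i]) (p : R * R).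

Lemma gdominatedZ (c : R[i]) f : gdominated f -> gdominated (fun p => c * f p).
Proof.
move=> [mf [B [e [e0 fB]]]]; split.
  by apply: cmeasurableM => //; exact: cmeasurable_cst.
exists (cmod c * B), e; split => // p.
by rewrite cmodM -mulrA ler_wpM2l ?cmod_ge0.
Qed.

Lemma gdominatedD f g : gdominated f -> gdominated g ->
  gdominated (fun p => f p + g p).
Proof.
move=> [mf [B [e [e0 fB]]]] [mg [B' [e' [e'0 gB]]]].
split; first exact: cmeasurableD.
exists (`|B| + `|B'|), (Num.min e e'); split => [|p]; first by rewrite lt_min e0.
have G x y y' : Num.min e e' <= y -> x <= y' * gaussian y p ->
    x <= `|y'| * gaussian (Num.min e e') p.
  move=> ey /le_trans; apply.
  apply: (@le_trans _ _ (`|y'| * gaussian y p)).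
    by rewrite ler_wpM2r ?gaussian_ge0 ?ler_norm.
  by rewrite ler_wpM2l// gaussian_le.
rewrite (le_trans (cmodD _ _))// mulrDl lerD//.
  by apply: G (fB p); rewrite ge_min lexx.
by apply: G (gB p); rewrite ge_min lexx orbT.
Qed.

(** The constant [C] pays for linear terms of [S] that are not purely imaginary, as in
    [phase_ph]. *)
Definition phase (e C : R) S := cmeasurable S /\
  forall p, complex.Re (S p) <= C - e * sqnorm p.

Definition osc S f : R[i] := cintegral2 (fun p => f p * cexp (S p)).

(** Half of the decay pays for the growth of [f]. The bound is chosen before [S] and so is uniform
    over all phases with the same [e] and [C]. *)
Lemma osc_dominated (e C : R) f : 0 < e -> tempered f ->
  exists B, 0 <= B /\ forall S, phase e C S ->
    forall p, cmod (f p * cexp (S p)) <= B * gaussian (e / 2) p.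
Proof.
move=> e0 tf; have [D [n [D0 fD]]] := tempered_exp tf.
have e2 : 0 < e / 2 by rewrite divr_gt0.
have [K [K0 hK]] := exprn_le_expR n e2.
exists (D * K * expR C); split; first by rewrite !mulr_ge0// expR_ge0.
move=> S [_ SC] p; rewrite cmodM cmod_cexp /gaussian.
have -> : D * K * expR C * expR (- (e / 2) * sqnorm p) =
    (D * (K * expR (e / 2 * sqnorm p))) * expR (C - e * sqnorm p).
  have -> : C - e * sqnorm p =
      C + (- (e / 2) * sqnorm p + - (e / 2 * sqnorm p)) by field.
  rewrite !expRD expRN; field.
  by rewrite gt_eqF// expR_gt0.
apply: ler_pM; rewrite ?cmod_ge0 ?expR_ge0//; last by rewrite ler_expR.
by rewrite (le_trans (fD n p (leqnn n)))// ler_wpM2l// hK// sqnorm_ge0.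
Qed.

Lemma gdominated_osc (e C : R) S f : 0 < e -> phase e C S -> tempered f ->
  gdominated (fun p => f p * cexp (S p)).
Proof.
move=> e0 pS tf; split.
  by apply: cmeasurableM; [case: tf|apply: cmeasurable_cexp; case: pS].
have [B [_ hB]] := osc_dominated C e0 tf.
by exists B, (e / 2); split; [rewrite divr_gt0|exact: hB].
Qed.

Lemma osc_bound (e C : R) f : 0 < e -> tempered f ->
  exists B, 0 <= B /\ forall S, phase e C S -> cmod (osc S f) <= B.
Proof.
move=> e0 tf; have [B [B0 hB]] := osc_dominated C e0 tf.
exists (2 * B * gmass (e / 2)); split; first by rewrite !mulr_ge0// gmass_ge0.
move=> S pS; apply: cmod_cintegral2; rewrite ?divr_gt0//; last exact: hB.
by apply: cmeasurableM; [case: tf|apply: cmeasurable_cexp; case: pS].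
Qed.

Lemma oscD (e C : R) S f g : 0 < e -> phase e C S -> tempered f -> tempered g ->
  osc S (fun p => f p + g p) = osc S f + osc S g.
Proof.
move=> e0 pS tf tg; rewrite /osc.
under [in LHS]eq_fun do rewrite mulrDl.
by apply: cintegral2D; exact: gdominated_osc pS _.
Qed.

Lemma oscZ (e C : R) S f (c : R[i]) : 0 < e -> phase e C S -> tempered f ->
  osc S (fun p => c * f p) = c * osc S f.
Proof.
move=> e0 pS tf; rewrite /osc.
under [in LHS]eq_fun do rewrite -mulrA.
by apply: cintegral2Z; exact: gdominated_osc pS _.
Qed.

Lemma phase_shift (e C K h : R) S (D : R * R -> R[i]) :
  phase e C S -> cmeasurable D ->
  (forall p, cmod (D p) <= h * K * (1 + sqnorm p)) -> h * K <= e / 4 ->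
  phase (e / 2) (C + e / 4) (fun p => S p + D p).
Proof.
move=> [mS hS] mD hD hK; split; first exact: cmeasurableD.
move=> p; rewrite ReD.
have h1 := le_trans (ler_norm _) (le_trans (ler_Re_cmod _) (hD p)).
have h2 := hS p.
have s0 := sqnorm_ge0 p.
have := ler_wpM2r (sqnorm1_ge0 p) hK.
have : 0 <= h * K * (1 + sqnorm p) := le_trans (cmod_ge0 _) (hD p).
have : 0 <= h * K.
  have := le_trans (cmod_ge0 _) (hD p).
  by rewrite pmulr_lge0// (lt_le_trans ltr01)// sqnorm1_ge1.
nra.
Qed.

(** Differentiation under the integral sign with a quadratic remainder. [D h] is not assumed linear
    in [h], because a translation of the plane changes the phase by a cubic polynomial in [h]. *)
Lemma osc_quadratic (e C K : R) S f (D1 : R * R -> R[i]) (D : R -> R * R -> R[i]) :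
  0 < e -> phase e C S -> tempered f -> tempered D1 -> 0 < K ->
  (forall h, cmeasurable (D h)) ->
  (forall (h : R) p, `|h| <= 1 -> cmod (D h p) <= `|h| * K * (1 + sqnorm p)) ->
  (forall (h : R) p, `|h| <= 1 ->
    cmod (D h p - h%:C * D1 p) <= h ^+ 2 * K * (1 + sqnorm p)) ->
  exists B d : R, 0 < d /\ forall h : R, `|h| <= d ->
    cmod (osc (fun p => S p + D h p) f - osc S f
          - h%:C * osc S (fun p => D1 p * f p)) <= B * h ^+ 2.
Proof.
move=> e0 pS tf tD1 K0 mD hD hD1.
have [A [n [A0 fA]]] := tempered_exp tf.
have e4 : 0 < e / 4 by rewrite divr_gt0.
(* The exponent is [n] for [f] plus 2 for the square of the bound on [D h]. *)
have [Q [Q0 hQ]] := exprn_le_expR (n + 2) e4.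
(* For [|h| <= d], [cexp (D h p)] grows at most like [exp (e / 4 * (1 + |p|^2))]. This costs a
   quarter of the decay and the polynomial another quarter, so that the rate [e / 2] remains. *)
pose d := Num.min 1 (e / 4 / K).
have d0 : 0 < d by rewrite lt_min ltr01/= divr_gt0.
pose B0 := A * Q * (2 * K ^+ 2 + K) * expR (C + e / 4).
exists (2 * B0 * gmass (e / 2)), d; split => // h.
rewrite le_min => /andP[h1]; rewrite ler_pdivlMr// => hK.
have pSD : phase (e / 2) (C + e / 4) (fun p => S p + D h p).
  by apply: phase_shift pS (mD h) _ hK => p; exact: hD.
have e2 : 0 < e / 2 by rewrite divr_gt0.
pose g p := f p * (cexp (D h p) - 1 - h%:C * D1 p) * cexp (S p).
have E : osc (fun p => S p + D h p) f - osc S f - h%:C * osc S (fun p => D1 p * f p)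
    = cintegral2 g.
  have gSD := gdominated_osc e2 pSD tf.
  have gS := gdominated_osc e0 pS tf.
  have gD := gdominated_osc e0 pS (temperedM tD1 tf).
  rewrite -[- osc S f]mulN1r -mulNr /osc -!cintegral2Z// -!cintegral2D//;
    try by do ?apply: gdominatedD => //; exact: gdominatedZ.
  congr cintegral2; apply/funext => p; rewrite /g cexpD; ring.
rewrite E.
have -> : 2 * B0 * gmass (e / 2) * h ^+ 2 = 2 * (h ^+ 2 * B0) * gmass (e / 2) by ring.
apply: cmod_cintegral2 => //.
  apply: cmeasurableM; last by apply: cmeasurable_cexp; case: pS.
  apply: cmeasurableM; first by case: tf.
  have -> : (fun p => cexp (D h p) - 1 - h%:C * D1 p) =
      (fun p => cexp (D h p) + - 1 + (- h%:C) * D1 p).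
    by apply/funext => p; rewrite mulNr.
  apply: cmeasurableD; first by apply: cmeasurableD;
    [exact: cmeasurable_cexp|exact: cmeasurable_cst].
  by apply: cmeasurableM; [exact: cmeasurable_cst|case: tD1].
move=> p; set m := 1 + sqnorm p.
have m1 : 1 <= m := sqnorm1_ge1 p.
have m0 : 0 <= m := sqnorm1_ge0 p.
have bD : cmod (cexp (D h p) - 1 - h%:C * D1 p) <=
    h ^+ 2 * (2 * K ^+ 2 + K) * m ^+ 2 * expR (e / 4 * m).
  (* Two errors of order [h^2]: the remainder of the exponential, quadratic in [D h p], and the
     nonlinearity of [D h] in [h]. *)
  have -> : cexp (D h p) - 1 - h%:C * D1 p =
    (cexp (D h p) - 1 - D h p) + (D h p - h%:C * D1 p) by ring.
  rewrite (le_trans (cmodD _ _))//.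
  have b1 : cmod (cexp (D h p) - 1 - D h p) <=
      2 * ((`|h| * K * m) ^+ 2 * expR (e / 4 * m)).
    rewrite (le_trans (cexp_quadratic _))// ler_pM2l// ler_pM ?exprn_ge0 ?cmod_ge0 ?expR_ge0//.
      by rewrite lerXn2r ?nnegrE ?cmod_ge0 ?mulr_ge0 ?hD// ltW.
    by rewrite ler_expR (le_trans (hD _ _ h1))// ler_wpM2r.
  rewrite (le_trans (lerD b1 (hD1 _ _ h1)))//.
  rewrite !exprMn (real_normK (num_real h)).
  have e1 : 1 <= expR (e / 4 * m).
    by rewrite (le_trans _ (expR_ge1Dx _))// lerDl mulr_ge0// ltW.
  have : h ^+ 2 * K * m <= h ^+ 2 * K * (m ^+ 2 * expR (e / 4 * m)).
    rewrite ler_wpM2l//; first by rewrite mulr_ge0 ?sqr_ge0// ltW.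
    by rewrite expr2 -mulrA ler_peMr// mulr_ege1.
  by move=> b2; rewrite -/m; nra.
rewrite /g cmodM cmod_cexp cmodM.
have bS := (pS.2 p).
have bf := fA n p (leqnn n).
rewrite /B0 /gaussian.
apply: (@le_trans _ _ ((A * m ^+ n) * (h ^+ 2 * (2 * K ^+ 2 + K) * m ^+ 2 *
    expR (e / 4 * m)) * expR (C - e * sqnorm p))).
  apply: ler_pM; rewrite ?mulr_ge0 ?cmod_ge0 ?expR_ge0 ?ler_expR//.
  by apply: ler_pM; rewrite ?cmod_ge0.
have := hQ (sqnorm p) (sqnorm_ge0 p); rewrite exprD -/m => hm.
have -> : A * m ^+ n * (h ^+ 2 * (2 * K ^+ 2 + K) * m ^+ 2 * expR (e / 4 * m))
  * expR (C - e * sqnorm p) = (A * (h ^+ 2 * (2 * K ^+ 2 + K)) *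
  (expR (e / 4 * m) * expR (C - e * sqnorm p))) * (m ^+ n * m ^+ 2) by ring.
have -> : h ^+ 2 * (A * Q * (2 * K ^+ 2 + K) * expR (C + e / 4)) *
    expR (- (e / 2) * sqnorm p) = (A * (h ^+ 2 * (2 * K ^+ 2 + K)) *
  (expR (e / 4 * m) * expR (C - e * sqnorm p))) * (Q * expR (e / 4 * sqnorm p)).
  have -> : expR (e / 4 * m) * expR (C - e * sqnorm p) =
     expR (C + e / 4) * expR (- (e / 2) * sqnorm p) * expR (- (e / 4 * sqnorm p)).
    by rewrite -!expRD; congr expR; rewrite /m; field.
  rewrite expRN; field.
  by rewrite gt_eqF// expR_gt0.
rewrite ler_wpM2l//; apply: mulr_ge0; last by rewrite mulr_ge0 ?expR_ge0.
apply: mulr_ge0 => //; apply: mulr_ge0; first exact: sqr_ge0.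
by rewrite addr_ge0 ?mulr_ge0 ?sqr_ge0// ltW.
Qed.

End Oscillatory.

(** * Derivatives at 0 with a quadratic remainder *)

Section QuadraticDerivative.
Variable R : realType.
Implicit Types (g : R -> R[i]) (l : R[i]).

Definition qder g l := exists B d : R, 0 < d /\
  forall h : R, `|h| <= d -> cmod (g h - g 0 - h%:C * l) <= B * h ^+ 2.

Lemma qder_eq g g' l l' : qder g l -> g =1 g' -> l = l' -> qder g' l'.
Proof. by move=> h /funext <- <-. Qed.

Lemma qderD g g' l l' : qder g l -> qder g' l' ->
  qder (fun h => g h + g' h) (l + l').
Proof.
move=> [B [d [d0 H]]] [B' [d' [d'0 H']]]; exists (B + B'), (Num.min d d').
split => [|h]; first by rewrite lt_min d0.
rewrite le_min => /andP[/H h1 /H' h2].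
rewrite mulrDl (le_trans _ (lerD h1 h2))// (le_trans _ (cmodD _ _))//.
rewrite le_eqVlt; apply/orP; left; apply/eqP; congr cmod; ring.
Qed.

Lemma qderZ g l (c : R[i]) : qder g l -> qder (fun h => c * g h) (c * l).
Proof.
move=> [B [d [d0 H]]]; exists (cmod c * B), d; split => // h /H h1.
rewrite (_ : c * g h - _ - _ = c * (g h - g 0 - h%:C * l)); last by ring.
by rewrite cmodM -mulrA ler_wpM2l ?cmod_ge0.
Qed.

(** The product rule for a factor [h]. It is needed when an identity whose coefficients move with
    [h] is differentiated. *)
Lemma qder_mulh g l : qder g l -> qder (fun h => h%:C * g h) (g 0).
Proof.
move=> [B [d [d0 H]]]; exists (`|B| + cmod l), (Num.min 1 d).
split => [|h]; first by rewrite lt_min ltr01.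
rewrite le_min => /andP[h1 /H h2].
rewrite (_ : _ - _ - _ = h%:C * (g h - g 0 - h%:C * l) + h%:C ^+ 2 * l); last first.
  by rewrite rmorph0; ring.
rewrite (le_trans (cmodD _ _))// [cmod (_ ^+ _ * _)]cmodM cmodX cmodM.
rewrite cmod_real (real_normK (num_real h)).
rewrite mulrDl lerD//; last by rewrite mulrC.
have : cmod (g h - g 0 - h%:C * l) <= `|B| * h ^+ 2.
  by rewrite (le_trans h2)// ler_wpM2r ?sqr_ge0 ?ler_norm.
have := cmod_ge0 (g h - g 0 - h%:C * l); have := normr_ge0 h; nra.
Qed.

(** Turns an invariance into an identity: a quantity known not to depend on [h] has vanishing
    derivative. Both the integration by parts and its induction on degree end this way. *)
Lemma qder_cst_eq0 g l : qder g l -> (forall h, g h = g 0) -> l = 0.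
Proof.
move=> [B [d [d0 H]]] g0; apply: cmod_eq0; apply/eqP.
rewrite eq_le cmod_ge0 andbT; apply/ler_addgt0Pr => e e0; rewrite add0r.
pose h := Num.min d (e / (`|B| + 1)).
have B1 : 0 < `|B| + 1 by rewrite ltr_wpDl.
have h0 : 0 < h by rewrite lt_min d0 divr_gt0.
have : cmod (g h - g 0 - h%:C * l) <= B * h ^+ 2.
  by apply: H; rewrite (ger0_norm (ltW h0)) /h ge_min lexx.
rewrite g0 subrr add0r cmodN cmodM cmod_real (ger0_norm (ltW h0)).
rewrite expr2 mulrA [B * h]mulrC -mulrA ler_pM2l//.
have he : h * (`|B| + 1) <= e by rewrite -ler_pdivlMr// /h ge_min lexx orbT.
have := ler_norm B; nra.
Qed.

End QuadraticDerivative.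

(** * The phases, their moments, and derivatives of moments in the coefficients *)

Section UmbilicPhase.
Variable R : realType.
Local Notation C := R[i].

(** Used both for a phase and for a direction in which a phase is varied; the fields follow the
    letters [a, b, c, d, s] of the overview. *)
Record coef := Coef { ca : C; cb : C; cc : C; cd : C; cs : C }.

Implicit Types (x y : coef) (p : R * R).

Definition cadd (h : C) x y := Coef (ca x + h * ca y) (cb x + h * cb y)
  (cc x + h * cc y) (cd x + h * cd y) (cs x + h * cs y).

Lemma cadd0 x y : cadd 0 x y = x.
Proof. by case: x => a b c d s; rewrite /cadd/= !mul0r !addr0. Qed.

Lemma caddA h k x y : cadd h (cadd k x y) y = cadd (k + h) x y.
Proof. by rewrite /cadd/= !mulrDl !addrA. Qed.

Definition quad x p : C := ca x * zeta p + cb x * zetab p + cc x * zeta p ^+ 2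
  + cd x * zetab p ^+ 2 + cs x * (zeta p * zetab p).

(** This is [i] times the real part of [zeta^3], that is [i (xi^3 - 3 xi eta^2)]. *)
Definition cubic p : C := 'i / 2 * (zeta p ^+ 3 + zetab p ^+ 3).

Definition ph x p := quad x p + cubic p.

Lemma ph_cadd h x y : ph (cadd h x y) = (fun p => ph x p + h * quad y p).
Proof. by apply/funext => p; rewrite /ph /quad/=; ring. Qed.

Definition cbound (r : R) x := [/\ cmod (ca x) <= r, cmod (cb x) <= r,
  cmod (cc x) <= r, cmod (cd x) <= r & cmod (cs x) <= r].

(** The first condition makes the terms in [zeta^2] and [zetab^2] purely imaginary together; the
    second makes [e] the damping rate. The linear coefficients stay free and need not give an
    imaginary form, which the induction in [ibp_mom] and the translation both exploit. *)
Definition admissible (e : R) x :=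
  cd x = - (cc x)^*%C /\ complex.Re (cs x) = - e.

Lemma tempered_quad x : tempered (quad x).
Proof.
by do ?apply: temperedD; apply: temperedM; do ?[exact: tempered_cst |
  exact: tempered_zeta|exact: tempered_zetab|apply: temperedX|apply: temperedM].
Qed.

Lemma tempered_cubic : tempered cubic.
Proof.
apply: temperedM; first exact: tempered_cst.
by apply: temperedD; apply: temperedX; [exact: tempered_zeta|exact: tempered_zetab].
Qed.

Lemma tempered_ph x : tempered (ph x).
Proof. by apply: temperedD; [exact: tempered_quad|exact: tempered_cubic]. Qed.

Lemma cmodD_le (z w : C) (r1 r2 : R) : cmod z <= r1 -> cmod w <= r2 ->
  cmod (z + w) <= r1 + r2.
Proof. by move=> h1 h2; rewrite (le_trans (cmodD _ _))// lerD. Qed.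

Lemma quad_bound r x p : cbound r x -> cmod (quad x p) <= 5 * r * (1 + sqnorm p).
Proof.
move=> [ha hb hc hd hs]; have z1 := cmod_zeta_le p; have z2 := cmod_zeta p.
have r0 : 0 <= r := le_trans (cmod_ge0 _) ha.
have s0 := sqnorm_ge0 p.
have A (w v : C) : cmod w <= r -> cmod v <= 1 + sqnorm p ->
    cmod (w * v) <= r * (1 + sqnorm p).
  by move=> *; rewrite cmodM ler_pM// cmod_ge0.
have sq : cmod (zeta p) ^+ 2 <= 1 + sqnorm p by rewrite z2 lerDr.
have := A _ _ ha z1.
have := A _ (zetab p) hb; rewrite cmod_zetab => /(_ z1).
have := A _ (zeta p ^+ 2) hc; rewrite cmodX => /(_ sq).
have := A _ (zetab p ^+ 2) hd; rewrite cmodX cmod_zetab => /(_ sq).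
have := A _ (zeta p * zetab p) hs; rewrite [X in X <= _ -> _]cmodM cmod_zetab -expr2 => /(_ sq).
rewrite /quad => h1 h2 h3 h4 h5.
apply: le_trans (cmodD_le (cmodD_le (cmodD_le (cmodD_le h5 h4) h3) h2) h1) _.
lra.
Qed.

Lemma zetabE p : zetab p = (zeta p)^*%C.
Proof. by []. Qed.

Lemma Re_subJ (z : C) : complex.Re (z - z^*%C) = 0.
Proof. by case: z => u v /=; rewrite subrr. Qed.

Lemma Re_iaddJ (z : C) : complex.Re ('i / 2 * (z + z^*%C)) = 0.
Proof.
have -> : 'i / 2 = (2^-1 : R)%:C * 'i :> C.
  by rewrite fmorphV/= rmorph_nat mulrC.
by rewrite -mulrA ReMr ReM/=; case: z => u v /=; rewrite subrr; ring.
Qed.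

Lemma Re_ph e x p : admissible e x ->
  complex.Re (ph x p) = complex.Re (ca x * zeta p + cb x * zetab p) - e * sqnorm p.
Proof.
move=> [hd hs].
have -> : ph x p = (ca x * zeta p + cb x * zetab p) +
   (cc x * zeta p ^+ 2 - (cc x * zeta p ^+ 2)^*%C) + cs x * (sqnorm p)%:C
   + 'i / 2 * (zeta p ^+ 3 + (zeta p ^+ 3)^*%C).
  rewrite /ph /quad /cubic hd sqnorm_zeta zetabE !rmorphXn/= rmorphM rmorphXn/=.
  ring.
rewrite ReD Re_iaddJ addr0 ReD ReD Re_subJ addr0; congr (_ + _).
by rewrite mulrC ReMr hs mulrN mulrC.
Qed.

(** Half of the damping absorbs the linear terms, by [2 r t <= 2 r^2 / e + (e / 2) t^2]. *)
Lemma phase_ph e r x : 0 < e -> admissible e x -> cmod (ca x) <= r ->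
  cmod (cb x) <= r -> phase (e / 2) (2 * r ^+ 2 / e) (ph x).
Proof.
move=> e0 ax ha hb; split; first by case: (tempered_ph x).
move=> p; rewrite (Re_ph _ ax).
have r0 : 0 <= r := le_trans (cmod_ge0 _) ha.
have : complex.Re (ca x * zeta p + cb x * zetab p) <= 2 * r * cmod (zeta p).
  rewrite (le_trans (ler_norm _))// (le_trans (ler_Re_cmod _))//.
  rewrite (le_trans (cmodD _ _))// !cmodM cmod_zetab -mulrA mulrDl mul1r.
  by rewrite lerD// ler_wpM2r ?cmod_ge0.
rewrite -(cmod_zeta p); set z := cmod (zeta p) => h.
have : 2 * r * z <= 2 * r ^+ 2 / e + e / 2 * z ^+ 2.
  rewrite -(@ler_pM2r _ (2 * e))// ?mulr_gt0//.
  have -> : (2 * r ^+ 2 / e + e / 2 * z ^+ 2) * (2 * e) =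
     4 * r ^+ 2 + (e * z) ^+ 2 by field; rewrite gt_eqF.
  have := sqr_ge0 (2 * r - e * z); nra.
lra.
Qed.

Lemma phase_ph_ex e x : 0 < e -> admissible e x ->
  exists K, phase (e / 2) K (ph x).
Proof.
move=> e0 ax.
exists (2 * (Num.max (cmod (ca x)) (cmod (cb x))) ^+ 2 / e).
by apply: phase_ph => //; rewrite le_max lexx ?orbT.
Qed.

Definition mon (j k : nat) p : C := zeta p ^+ j * zetab p ^+ k.

Lemma tempered_mon j k : tempered (mon j k).
Proof.
by apply: temperedM; apply: temperedX; [exact: tempered_zeta|exact: tempered_zetab].
Qed.

Definition mom x (j k : nat) : C := osc (ph x) (mon j k).

(* The action on moments of multiplication by [quad y] under the integral. *)
Definition mulq y (m : nat -> nat -> C) (j k : nat) : C :=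
  ca y * m j.+1 k + cb y * m j k.+1 + cc y * m j.+2 k + cd y * m j k.+2
  + cs y * m j.+1 k.+1.

(** A polynomial is listed as triples (coefficient, [j], [k]), so that one induction serves both
    multiplication by [quad y] and the integration by parts formulas. *)
Lemma osc_lincomb e x (s : seq (C * nat * nat)) : 0 < e -> admissible e x ->
  osc (ph x) (fun p => \sum_(t <- s) t.1.1 * mon t.1.2 t.2 p) =
  \sum_(t <- s) t.1.1 * mom x t.1.2 t.2.
Proof.
move=> e0 ax; have [K pK] := phase_ph_ex e0 ax.
have e2 : 0 < e / 2 by rewrite divr_gt0.
have tm t : tempered (fun p => t.1.1 * mon t.1.2 t.2 p).
  by apply: temperedM; [exact: tempered_cst|exact: tempered_mon].
have ts l : tempered (fun p => \sum_(t <- l) t.1.1 * mon t.1.2 t.2 p).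
  elim: l => [|t l IH].
    by under eq_fun do rewrite big_nil; exact: tempered_cst.
  by under eq_fun do rewrite big_cons; exact: temperedD.
elim: s => [|t s IH].
  rewrite big_nil; under eq_fun do rewrite big_nil -(mul0r 1).
  by rewrite (oscZ _ e2 pK) ?mul0r//; exact: tempered_cst.
rewrite big_cons -IH; under eq_fun do rewrite big_cons.
rewrite (oscD e2 pK) ?(oscZ _ e2 pK)//; exact: tempered_mon.
Qed.

Lemma osc_quad_mon e x y j k : 0 < e -> admissible e x ->
  osc (ph x) (fun p => quad y p * mon j k p) = mulq y (mom x) j k.
Proof.
move=> e0 ax.
have := osc_lincomb [:: (ca y, j.+1, k); (cb y, j, k.+1); (cc y, j.+2, k);
  (cd y, j, k.+2); (cs y, j.+1, k.+1)] e0 ax.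
rewrite !big_cons big_nil /= addr0 !addrA -/(mulq _ _ _ _) => <-.
congr osc; apply/funext => p; rewrite !big_cons big_nil /quad /mon /= !exprS; ring.
Qed.

Lemma cbound_ex x : exists r, 0 < r /\ cbound r x.
Proof.
exists (1 + cmod (ca x) + cmod (cb x) + cmod (cc x) + cmod (cd x) + cmod (cs x)).
have := (cmod_ge0 (ca x), cmod_ge0 (cb x), cmod_ge0 (cc x), cmod_ge0 (cd x), cmod_ge0 (cs x)).
by move=> [[[[? ?] ?] ?] ?]; split; [lra|split; lra].
Qed.

Lemma mom_deriv e x y j k : 0 < e -> admissible e x ->
  qder (fun h => mom (cadd h%:C x y) j k) (mulq y (mom x) j k).
Proof.
move=> e0 ax; have [K pK] := phase_ph_ex e0 ax.
have e2 : 0 < e / 2 by rewrite divr_gt0.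
have [r [r0 yr]] := cbound_ex y.
have r5 : 0 < 5 * r by rewrite mulr_gt0.
have [|h p _|h p _|B [d [d0 H]]] := osc_quadratic (D := fun h p => h%:C * quad y p)
    e2 pK (tempered_mon j k) (tempered_quad y) r5.
- by move=> h; case: (temperedM (tempered_cst h%:C) (tempered_quad y)).
- by rewrite cmodM cmod_real -mulrA ler_wpM2l// quad_bound.
- rewrite subrr cmod0; apply: mulr_ge0 (sqnorm1_ge0 _).
  by apply: mulr_ge0 (ltW r5); exact: sqr_ge0.
exists B, d; split => // h /H.
by rewrite rmorph0 cadd0 /mom ph_cadd (osc_quad_mon _ _ _ e0 ax).
Qed.

End UmbilicPhase.

(** * Integration by parts from translation invariance *)

Section MomentRecursion.
Variable R : realType.
Local Notation C := R[i].
Implicit Types (x y : coef R) (p : R * R).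

Lemma osc_translation e K S f (a b : R) : 0 < e -> phase e K S -> tempered f ->
  osc (fun p => S (p.1 + a, p.2 + b)) (fun p => f (p.1 + a, p.2 + b)) = osc S f.
Proof.
move=> e0 pS tf.
exact: (cintegral2_translation a b (gdominated_osc e0 pS tf)).
Qed.

(** [dzeta] and [dzetab] are the derivatives of [ph x] in [zeta] and [zetab] taken as independent
    variables. *)
Definition dzeta x p : C :=
  ca x + 2 * cc x * zeta p + cs x * zetab p + 3 * 'i / 2 * zeta p ^+ 2.

Definition dzetab x p : C :=
  cb x + 2 * cd x * zetab p + cs x * zeta p + 3 * 'i / 2 * zetab p ^+ 2.

Lemma tempered_dzeta x : tempered (dzeta x).
Proof.
by do ?apply: temperedD; do ?[exact: tempered_cst|apply: temperedM];
  do ?[exact: tempered_cst | exact: tempered_zeta|exact: tempered_zetab|apply: temperedX].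
Qed.

Lemma tempered_dzetab x : tempered (dzetab x).
Proof.
by do ?apply: temperedD; do ?[exact: tempered_cst|apply: temperedM];
  do ?[exact: tempered_cst | exact: tempered_zeta|exact: tempered_zetab|apply: temperedX].
Qed.

(** [ddir] and [d2dir] are the coefficients of [h] and [h^2] when the phase is translated by [h c];
    the coefficient of [h^3] is constant in [p]. *)
Definition ddir (c : C) x p : C := c * dzeta x p + c^*%C * dzetab x p.

Definition d2dir (c : C) x p : C := cc x * c ^+ 2 + cd x * c^*%C ^+ 2
  + cs x * (c * c^*%C) + 3 * 'i / 2 * (c ^+ 2 * zeta p + c^*%C ^+ 2 * zetab p).

Lemma zeta_shift (h : R) (c : C) p :
  zeta (p.1 + h * complex.Re c, p.2 + h * complex.Im c) = zeta p + h%:C * c.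
Proof. by apply/eqP; rewrite eq_complex ReD ImD ReMr ImMr/= !eqxx. Qed.

Lemma zetab_shift (h : R) (c : C) p :
  zetab (p.1 + h * complex.Re c, p.2 + h * complex.Im c) = zetab p + h%:C * c^*%C.
Proof.
apply/eqP; rewrite eq_complex ReD ImD ReMr ImMr/= opprD.
by case: c => u v /=; rewrite mulrN !eqxx.
Qed.

Lemma ph_shift (h : R) (c : C) x p :
  ph x (p.1 + h * complex.Re c, p.2 + h * complex.Im c) =
  ph x p + (h%:C * ddir c x p + h%:C ^+ 2 * d2dir c x p
            + h%:C ^+ 3 * ('i / 2 * (c ^+ 3 + c^*%C ^+ 3))).
Proof.
rewrite /ph /quad /cubic zeta_shift zetab_shift /ddir /d2dir /dzeta /dzetab.
by field.
Qed.

(** The integral of the translated phase does not depend on the length [h] of the translation, so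
    its derivative, the integral of [ddir c x], vanishes. The directions [c = 1] and [c = i] give
    the sum and the difference of the two integrals. *)
Lemma osc_dzeta e x : 0 < e -> admissible e x ->
  osc (ph x) (dzeta x) = 0 /\ osc (ph x) (dzetab x) = 0.
Proof.
move=> e0 ax; have [K pK] := phase_ph_ex e0 ax.
have e2 : 0 < e / 2 by rewrite divr_gt0.
suff D c : cmod c <= 1 -> osc (ph x) (fun p => ddir c x p * 1) = 0.
  have E c : cmod c <= 1 ->
      c * osc (ph x) (dzeta x) + c^*%C * osc (ph x) (dzetab x) = 0.
    move=> /D; under eq_fun do rewrite mulr1.
    rewrite (oscD e2 pK); last 2 first.
    - by apply: temperedM; [exact: tempered_cst|exact: tempered_dzeta].
    - by apply: temperedM; [exact: tempered_cst|exact: tempered_dzetab].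
    by rewrite !(oscZ _ e2 pK) ?tempered_dzeta ?tempered_dzetab//;
      [exact: tempered_dzetab|exact: tempered_dzeta].
  have := E 1; rewrite cmod1 rmorph1 !mul1r => /(_ (lexx _)) E1.
  have := E 'i; rewrite cmod_i => /(_ (lexx _)).
  have -> : ('i : C)^*%C = - 'i by apply/eqP; rewrite eq_complex/= oppr0 !eqxx.
  move: E1 => /eqP; rewrite addr_eq0 => /eqP ->.
  rewrite mulrN mulNr -opprD => /eqP; rewrite oppr_eq0 -mulr2n -mulr_natl.
  rewrite !mulf_eq0 pnatr_eq0/= => /orP[|/eqP ->]; last by rewrite oppr0.
  by rewrite eq_complex/= oner_eq0 andbF.
move=> c1; have [r [r0 [ha hb hc hd hs]]] := cbound_ex x.
pose D h p := h%:C * ddir c x p + h%:C ^+ 2 * d2dir c x p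
            + h%:C ^+ 3 * ('i / 2 * (c ^+ 3 + c^*%C ^+ 3)).
have n2 : cmod (2 : C) = 2 by rewrite cmod_nat.
have n3 : cmod (3 : C) = 3 by rewrite cmod_nat.
have i2 : cmod ('i / 2 : C) = 2^-1 by rewrite cmodM cmodV cmod_i n2 mul1r.
have c1' : cmod c^*%C <= 1 by rewrite cmodJ.
have cX n : cmod (c ^+ n) <= 1 by rewrite cmodX exprn_ile1 ?cmod_ge0.
have cX' n : cmod (c^*%C ^+ n) <= 1 by rewrite cmodX exprn_ile1 ?cmod_ge0.
have M1 (z w : C) (a b : R) : cmod z <= a -> cmod w <= b -> cmod (z * w) <= a * b.
  by move=> *; rewrite cmodM ler_pM ?cmod_ge0.
have i3 : cmod (3 * 'i / 2 : C) <= 3 / 2.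
  by rewrite -mulrA cmodM i2 n3.
have z1 p := cmod_zeta_le p.
have z1b p : cmod (zetab p) <= 1 + sqnorm p by rewrite cmod_zetab.
have z2 p : cmod (zeta p ^+ 2) <= 1 + sqnorm p.
  by rewrite cmodX cmod_zeta lerDr.
have z2b p : cmod (zetab p ^+ 2) <= 1 + sqnorm p.
  by rewrite cmodX cmod_zetab cmod_zeta lerDr.
have n2' : cmod (2 : C) <= 2 by rewrite n2.
have bdir p : cmod (ddir c x p) <= (8 * r + 3) * (1 + sqnorm p).
  have m1 := sqnorm1_ge1 p.
  have h1 := cmodD_le (cmodD_le (cmodD_le ha (M1 _ _ _ _ (M1 _ _ _ _ n2' hc) (z1 p)))
    (M1 _ _ _ _ hs (z1b p))) (M1 _ _ _ _ i3 (z2 p)).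
  have h2 := cmodD_le (cmodD_le (cmodD_le hb (M1 _ _ _ _ (M1 _ _ _ _ n2' hd) (z1b p)))
    (M1 _ _ _ _ hs (z1 p))) (M1 _ _ _ _ i3 (z2b p)).
  apply: le_trans (cmodD_le (M1 _ _ _ _ c1 h1) (M1 _ _ _ _ c1' h2)) _; nra.
have bd2 p : cmod (d2dir c x p) <= (3 * r + 3) * (1 + sqnorm p).
  have m1 := sqnorm1_ge1 p.
  apply: le_trans (cmodD_le (cmodD_le (cmodD_le (M1 _ _ _ _ hc (cX 2))
    (M1 _ _ _ _ hd (cX' 2))) (M1 _ _ _ _ hs (M1 _ _ _ _ c1 c1')))
    (M1 _ _ _ _ i3 (cmodD_le (M1 _ _ _ _ (cX 2) (z1 p))
    (M1 _ _ _ _ (cX' 2) (z1b p))))) _; nra.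
have b3 : cmod ('i / 2 * (c ^+ 3 + c^*%C ^+ 3)) <= 1.
  rewrite cmodM i2; have := cmodD_le (cX 3) (cX' 3); lra.
have hX (h : R) n : cmod (h%:C ^+ n : C) = `|h| ^+ n by rewrite cmodX cmod_real.
have brem (h : R) p : `|h| <= 1 -> cmod (D h p - h%:C * ddir c x p) <=
   h ^+ 2 * (3 * r + 4) * (1 + sqnorm p).
  move=> h1; have -> : D h p - h%:C * ddir c x p = h%:C ^+ 2 * d2dir c x p
            + h%:C ^+ 3 * ('i / 2 * (c ^+ 3 + c^*%C ^+ 3)) by rewrite /D; ring.
  have h2 : cmod (h%:C ^+ 2 : C) <= h ^+ 2 by rewrite hX real_normK ?num_real.
  have h3 : cmod (h%:C ^+ 3 : C) <= h ^+ 2.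
    by rewrite hX exprS real_normK ?num_real// ler_piMl// sqr_ge0.
  apply: le_trans (cmodD_le (M1 _ _ _ _ h2 (bd2 p)) (M1 _ _ _ _ h3 b3)) _.
  have m1 := sqnorm1_ge1 p; have := sqr_ge0 h; nra.
have tdir : tempered (ddir c x).
  by apply: temperedD; apply: temperedM;
   [exact: tempered_cst|exact: tempered_dzeta|exact: tempered_cst|exact: tempered_dzetab].
have td2 : tempered (d2dir c x) := temperedD (tempered_cst _)
  (temperedM (tempered_cst _) (temperedD (temperedM (tempered_cst _) (@tempered_zeta R))
  (temperedM (tempered_cst _) (@tempered_zetab R)))).
(* One constant for both hypotheses of [osc_quadratic]: [8 r + 3] bounds the linear part of [D], and
   [3 r + 4] the rest. *)
have r7 : 0 < 11 * r + 7 by lra.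
have rE : (8 * r + 3) + (3 * r + 4) = 11 * r + 7 by lra.
have [h|h p h1|h p h1|B [d [d0 H]]] := @osc_quadratic R (e / 2) K (11 * r + 7) (ph x)
   (fun=> 1) (ddir c x) D e2 pK (tempered_cst 1) tdir r7.
- by case: (temperedD (temperedD (temperedM (tempered_cst h%:C) tdir)
    (temperedM (tempered_cst (h%:C ^+ 2)) td2))
    (tempered_cst (h%:C ^+ 3 * ('i / 2 * (c ^+ 3 + c^*%C ^+ 3))))).
- have -> : D h p = (D h p - h%:C * ddir c x p) + h%:C * ddir c x p by ring.
  apply: le_trans (cmodD_le (brem h p h1) (M1 _ _ `|h| _ _ (bdir p))) _.
    by rewrite cmod_real.
  have : h ^+ 2 <= `|h| by rewrite -(real_normK (num_real h)) expr2 ler_piMl.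
  move=> hh; have := ler_wpM2r (sqnorm1_ge0 p) hh; have := normr_ge0 h; nra.
- apply: le_trans (brem h p h1) _; rewrite ler_wpM2r ?sqnorm1_ge0//.
  rewrite ler_wpM2l ?sqr_ge0//; lra.
apply: (@qder_cst_eq0 R (fun h => osc (fun p => ph x p + D h p) (fun=> 1))).
  exists B, d; split => // h /H.
  have -> // : osc (fun p => ph x p + D 0 p) (fun=> 1) = osc (ph x) (fun=> 1).
  by congr osc; apply/funext => p; rewrite /D rmorph0; ring.
suff E h : osc (fun p => ph x p + D h p) (fun=> 1) = osc (ph x) (fun=> 1).
  by move=> h; rewrite !E.
rewrite -[RHS](osc_translation (h * complex.Re c) (h * complex.Im c) e2 pK)//;
  last exact: tempered_cst.
by congr osc; apply/funext => p; rewrite ph_shift.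
Qed.

(* [ibpz] and [ibpzb] are the moments of the [zeta]- and [zetab]-derivatives of
   [zeta ^+ j * zetab ^+ k * cexp (ph x)]. *)
Definition ibpz (m : nat -> nat -> C) x j k : C := j%:R * m j.-1 k
  + ca x * m j k + 2 * cc x * m j.+1 k + cs x * m j k.+1 + 3 * 'i / 2 * m j.+2 k.

Definition ibpzb (m : nat -> nat -> C) x j k : C := k%:R * m j k.-1
  + cb x * m j k + 2 * cd x * m j k.+1 + cs x * m j.+1 k + 3 * 'i / 2 * m j k.+2.

(** Varying [ca] or [cb] alone multiplies the integrand by [zeta] or [zetab] alone, and keeps the
    phase admissible with the same damping. *)
Definition dir_a : coef R := Coef 1 0 0 0 0.
Definition dir_b : coef R := Coef 0 1 0 0 0.

Lemma mulq_dir_a (m : nat -> nat -> C) j k : mulq dir_a m j k = m j.+1 k.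
Proof. by rewrite /mulq/= mul1r !mul0r !addr0. Qed.

Lemma mulq_dir_b (m : nat -> nat -> C) j k : mulq dir_b m j k = m j k.+1.
Proof. by rewrite /mulq/= mul1r !mul0r !addr0 add0r. Qed.

Lemma ibp_mom00 e x : 0 < e -> admissible e x ->
  ibpz (mom x) x 0 0 = 0 /\ ibpzb (mom x) x 0 0 = 0.
Proof.
move=> e0 ax; have [h1 h2] := osc_dzeta e0 ax; split.
- have := osc_lincomb [:: (ca x, 0%N, 0%N); (2 * cc x, 1%N, 0%N); (cs x, 0%N, 1%N);
    (3 * 'i / 2, 2%N, 0%N)] e0 ax.
  rewrite !big_cons big_nil /= addr0 !addrA /ibpz mul0r add0r => <-; rewrite -[RHS]h1.
  congr osc; apply/funext => p; rewrite !big_cons big_nil /dzeta /mon /=; ring.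
- have := osc_lincomb [:: (cb x, 0%N, 0%N); (2 * cd x, 0%N, 1%N); (cs x, 1%N, 0%N);
    (3 * 'i / 2, 0%N, 2%N)] e0 ax.
  rewrite !big_cons big_nil /= addr0 !addrA /ibpzb mul0r add0r => <-; rewrite -[RHS]h2.
  congr osc; apply/funext => p; rewrite !big_cons big_nil /dzetab /mon /=; ring.
Qed.

Lemma admissible_dir_a e x h : admissible e x -> admissible e (cadd h x dir_a).
Proof. by move=> [hd hs]; rewrite /admissible/= !mulr0 !addr0. Qed.

Lemma admissible_dir_b e x h : admissible e x -> admissible e (cadd h x dir_b).
Proof. by move=> [hd hs]; rewrite /admissible/= !mulr0 !addr0. Qed.

Lemma qder_dir_a e x j k : 0 < e -> admissible e x ->
  qder (fun h => mom (cadd h%:C x dir_a) j k) (mom x j.+1 k).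
Proof. by move=> e0 ax; rewrite -mulq_dir_a; exact: mom_deriv e0 ax. Qed.

Lemma qder_dir_b e x j k : 0 < e -> admissible e x ->
  qder (fun h => mom (cadd h%:C x dir_b) j k) (mom x j k.+1).
Proof. by move=> e0 ax; rewrite -mulq_dir_b; exact: mom_deriv e0 ax. Qed.

Lemma ibp_mom e x j k : 0 < e -> admissible e x ->
  ibpz (mom x) x j k = 0 /\ ibpzb (mom x) x j k = 0.
Proof.
(* The case (j.+1, k) is the derivative of the case (j, k) in the coefficient
   [ca x], and (j, k.+1) its derivative in [cb x]. *)
move=> e0; suff H : (forall x, admissible e x -> ibpz (mom x) x j k = 0) /\
    (forall x, admissible e x -> ibpzb (mom x) x j k = 0).
  by move=> ax; split; [exact: H.1|exact: H.2].
elim: j => [|j [IH1 IH2]].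
  elim: k => [|k [IH1 IH2]].
    by split => {}x ax; have [] := ibp_mom00 e0 ax.
  split => {}x ax.
  - have A h := IH1 _ (admissible_dir_b h ax).
    apply: (@qder_cst_eq0 R (fun h => ibpz (mom (cadd h%:C x dir_b)) (cadd h%:C x dir_b) 0 k));
      last by move=> h; rewrite !A.
    have d j' k' := qder_dir_b j' k' e0 ax.
    apply: qder_eq (qderD (qderD (qderD (qderD (qderZ 0 (d 0%N k)) (qderZ (ca x) (d 0%N k)))
      (qderZ (2 * cc x) (d 1%N k))) (qderZ (cs x) (d 0%N k.+1)))
      (qderZ (3 * 'i / 2) (d 2%N k))) _ _ => [h|].
      by rewrite /ibpz/= !mulr0 !addr0.
    by rewrite /ibpz/= !mul0r.
  - have A h := IH2 _ (admissible_dir_b h ax).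
    apply: (@qder_cst_eq0 R (fun h => ibpzb (mom (cadd h%:C x dir_b)) (cadd h%:C x dir_b) 0 k));
      last by move=> h; rewrite !A.
    have d j' k' := qder_dir_b j' k' e0 ax.
    (* The coefficient [cb x] itself moves with [h]; [qder_mulh] supplies the additional [mom x 0 k]
       that raises the factor [k] to [k.+1]. *)
    apply: qder_eq (qderD (qderD (qderD (qderD (qderD (qderZ k%:R (d 0%N k.-1))
      (qderZ (cb x) (d 0%N k)))
      (qder_mulh (d 0%N k))) (qderZ (2 * cd x) (d 0%N k.+1))) (qderZ (cs x) (d 1%N k)))
      (qderZ (3 * 'i / 2) (d 0%N k.+2))) _ _ => [h|].
      by rewrite /ibpzb/= !mulr0 !addr0 mulr1; ring.
    rewrite rmorph0 cadd0 /ibpzb/=.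
    by case: k {IH1 IH2 A d} => [|k] /=; rewrite -?(natr1 k.+1); ring.
split => {}x ax.
- have A h := IH1 _ (admissible_dir_a h ax).
  apply: (@qder_cst_eq0 R (fun h => ibpz (mom (cadd h%:C x dir_a)) (cadd h%:C x dir_a) j k));
    last by move=> h; rewrite !A.
  have d j' k' := qder_dir_a j' k' e0 ax.
  apply: qder_eq (qderD (qderD (qderD (qderD (qderD (qderZ j%:R (d j.-1 k)) (qderZ (ca x) (d j k)))
    (qder_mulh (d j k))) (qderZ (2 * cc x) (d j.+1 k))) (qderZ (cs x) (d j k.+1)))
    (qderZ (3 * 'i / 2) (d j.+2 k))) _ _ => [h|].
    by rewrite /ibpz/= !mulr0 !addr0 mulr1; ring.
  rewrite rmorph0 cadd0 /ibpz/=.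
  by case: j {IH1 IH2 A d} => [|j] /=; rewrite -?(natr1 j.+1); ring.
- have A h := IH2 _ (admissible_dir_a h ax).
  apply: (@qder_cst_eq0 R (fun h => ibpzb (mom (cadd h%:C x dir_a)) (cadd h%:C x dir_a) j k));
    last by move=> h; rewrite !A.
  have d j' k' := qder_dir_a j' k' e0 ax.
  apply: qder_eq (qderD (qderD (qderD (qderD (qderZ k%:R (d j k.-1)) (qderZ (cb x) (d j k)))
    (qderZ (2 * cd x) (d j k.+1))) (qderZ (cs x) (d j.+1 k)))
    (qderZ (3 * 'i / 2) (d j k.+2))) _ _ => [h|].
    by rewrite /ibpzb/= !mulr0 !addr0.
  by rewrite /ibpzb/=.
Qed.

End MomentRecursion.

(** * The growth rate of moments and its comparison with the factorial *)

Section Growth.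
Variable R : realType.
Implicit Types (K : R) (n : nat).

(* Stands for [(n`!)^(1/3)], up to a geometric factor. *)
Definition growth K n : R := K ^+ n * ((n %/ 3)`!)%:R.

Lemma fact_le_mono m n : (m <= n)%N -> (m`! <= n`!)%N.
Proof.
move=> mn; rewrite -(subnK mn); elim: (n - m)%N => [//|k IH].
by rewrite addSn factS (leq_trans IH)// leq_pmull.
Qed.

Lemma growth_ge1 K n : 1 <= K -> 1 <= growth K n.
Proof.
by move=> K1; rewrite mulr_ege1 ?exprn_ege1// ler1n fact_gt0.
Qed.

Lemma growth_ge0 K n : 1 <= K -> 0 <= growth K n.
Proof. by move=> /(growth_ge1 n); apply: le_trans. Qed.

Lemma growth_mono K m n : 1 <= K -> (m <= n)%N -> growth K m <= growth K n.
Proof.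
move=> K1 mn; apply: ler_pM; rewrite ?exprn_ge0 ?ler0n ?(le_trans ler01)//.
  by rewrite ler_weXn2l.
by rewrite ler_nat fact_le_mono// leq_div2r.
Qed.

(** Power and factorial carry separate indices, since [ibp_growth] keeps one factor [K] in
    reserve. *)
Lemma growth_le K m n l : 1 <= K -> (m <= l)%N -> (m <= n)%N ->
  growth K m <= K ^+ l * ((n %/ 3)`!)%:R.
Proof.
move=> K1 ml mn; apply: ler_pM; rewrite ?exprn_ge0 ?ler0n ?(le_trans ler01)//.
  by rewrite ler_weXn2l.
by rewrite ler_nat fact_le_mono// leq_div2r.
Qed.

(** The integer factor is paid for by the drop of three degrees, which lowers [n %/ 3] by one. With
    [q = n %/ 3], [j <= n + 3 <= 3 q + 5 <= 5 (q + 1)], whence the constant 5. *)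
Lemma growth_rec3 K j n : 1 <= K -> (j <= n.+3)%N ->
  j%:R * growth K n <= 5 * (K ^+ n.+2 * ((n.+3 %/ 3)`!)%:R).
Proof.
move=> K1 jn.
have -> : (n.+3 %/ 3 = (n %/ 3).+1)%N by lia.
rewrite factS /growth natrM.
have h1 : K ^+ n <= K ^+ n.+2 by rewrite ler_weXn2l// (leqW (leqnSn n)).
have h2 : (j%:R : R) <= 5 * ((n %/ 3).+1)%:R.
  by rewrite -(natrM R 5) ler_nat; lia.
have -> : 5 * (K ^+ n.+2 * (((n %/ 3).+1)%:R * ((n %/ 3)`!)%:R)) =
  (5 * ((n %/ 3).+1)%:R) * (K ^+ n.+2 * ((n %/ 3)`!)%:R) :> R by ring.
have K0 : 0 <= K := le_trans ler01 K1.
apply: ler_pM => //; first by rewrite mulr_ge0 ?exprn_ge0.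
by rewrite ler_wpM2r.
Qed.

Lemma expn_fact_small (X e : R) : 0 <= X -> 0 < e ->
  exists N : nat, forall n, (N <= n)%N -> X ^+ n / n`!%:R <= e.
Proof.
move=> X0 e0.
have /cvgrPdist_le/(_ _ e0)[N _ H] := cvg_series_cvg_0 (is_cvg_series_exp_coeff X).
exists N => n /H; rewrite sub0r normrN /exp_coeff /= ger0_norm//.
by rewrite divr_ge0 ?exprn_ge0.
Qed.

(** With [q = (2 n + 2) %/ 3] and [p = n - q], the binomial coefficient being at least 1 gives
    [q! / n! <= 1 / p!]. As [p] is about [n / 3], the geometric factors are bounded by a power of
    exponent [p], and an exponential series remains. *)
Lemma growth_fact_small (A B K e : R) : 0 <= A -> 0 <= B -> 1 <= K -> 0 < e ->
  exists N : nat, forall n, (N <= n)%N ->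
    A * (B ^+ n * growth K (2 * n + 2)%N) / n`!%:R <= e.
Proof.
move=> A0 B0 K1 e0.
have K0 : 0 <= K := le_trans ler01 K1.
pose X := Num.max 1 (B * K ^+ 2).
have X1 : 1 <= X by rewrite le_max lexx.
have X0 : 0 <= X := le_trans ler01 X1.
pose D := A * K ^+ 2 * X ^+ 2 + 1.
have D0 : 0 < D.
  have : 0 <= A * K ^+ 2 * X ^+ 2 by rewrite !mulr_ge0// exprn_ge0.
  rewrite /D; lra.
have [P HP] := expn_fact_small (exprn_ge0 3 X0) (divr_gt0 e0 D0).
(* Chosen so that [p >= (n - 2) / 3 >= P]. *)
exists (3 * P + 2)%N => n nN.
set q := ((2 * n + 2) %/ 3)%N; pose p := (n - q)%N.
have qn : (q <= n)%N by rewrite /q; lia.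
have pP : (P <= p)%N by rewrite /p /q; lia.
have np : (n <= 3 * p + 2)%N by rewrite /p /q; lia.
have hf : (q`!%:R : R) / n`!%:R <= (p`!%:R)^-1.
  rewrite ler_pdivrMr ?ltr0n ?fact_gt0// mulrC ler_pdivlMr ?ltr0n ?fact_gt0//.
  rewrite -natrM ler_nat -(bin_fact qn) leq_pmull// bin_gt0//.
have hX : (B * K ^+ 2) ^+ n <= X ^+ 2 * (X ^+ 3) ^+ p.
  apply: (@le_trans _ _ (X ^+ n)).
    by rewrite lerXn2r ?nnegrE ?mulr_ge0 ?exprn_ge0// le_max lexx orbT.
  by rewrite -exprM -exprD ler_weXn2l// addnC.
have -> : A * (B ^+ n * growth K (2 * n + 2)) / n`!%:R =
    A * K ^+ 2 * (B * K ^+ 2) ^+ n * (q`!%:R / n`!%:R).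
  have E : K ^+ (2 * n + 2)%N = (K ^+ 2) ^+ n * K ^+ 2 by rewrite exprD exprM.
  rewrite /growth E [(B * _) ^+ n]exprMn -/q;
  move: ((K ^+ 2) ^+ n) (B ^+ n) (q`!%:R : R) ((n`!%:R : R)^-1).
  by clear; move=> *; ring.
apply: (@le_trans _ _ (A * K ^+ 2 * (X ^+ 2 * (X ^+ 3) ^+ p) * (p`!%:R)^-1)).
  apply: ler_pM => //; rewrite ?divr_ge0 ?mulr_ge0 ?exprn_ge0 ?mulr_ge0 ?exprn_ge0//.
  by rewrite ler_wpM2l// mulr_ge0// exprn_ge0.
have := HP p pP; rewrite ler_pdivlMr// => h.
apply: le_trans h.
have -> : A * K ^+ 2 * (X ^+ 2 * (X ^+ 3) ^+ p) / p`!%:R =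
  (X ^+ 3) ^+ p / p`!%:R * (A * K ^+ 2 * X ^+ 2) by ring.
by rewrite ler_wpM2l ?divr_ge0 ?exprn_ge0// /D lerDl.
Qed.

End Growth.

(** * From the four base moments to all moments *)

Section MomentBounds.
Variable R : realType.
Local Notation C := R[i].
Implicit Types (x y : coef R) (m : nat -> nat -> C).

(** Each use of the recursion costs [K = 5 + 4 r]: 5 for the integer factor by [growth_rec3], and
    [r + 2 r + r] for the three coefficients; dividing by the leading [3 / 2] only helps. [ibpz]
    lowers [j] when [j >= 2], and [ibpzb] lowers [k] when [j <= 1] and [k >= 2]. *)
Lemma ibp_growth (m : nat -> nat -> C) x (r N : R) : 0 <= N -> cbound r x ->
  (forall j k, ibpz m x j k = 0) -> (forall j k, ibpzb m x j k = 0) ->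
  (forall j k, (j <= 1)%N -> (k <= 1)%N -> cmod (m j k) <= N) ->
  forall j k, cmod (m j k) <= N * growth (5 + 4 * r) (j + k).
Proof.
move=> N0 [ha hb hc hd hs] I1 I2 base.
have r0 : 0 <= r := le_trans (cmod_ge0 _) ha.
set K := 5 + 4 * r; have K1 : 1 <= K by rewrite /K; lra.
have M1 (z w : C) (a b : R) : cmod z <= a -> cmod w <= b -> cmod (z * w) <= a * b.
  by move=> *; rewrite cmodM ler_pM ?cmod_ge0.
have n2 : cmod (2 : C) <= 2 by rewrite cmod_nat.
have i3 : cmod (3 * 'i / 2 : C) = 3 / 2 by rewrite !cmodM cmodV !cmod_nat cmod_i mulr1.
have U0 n l : 0 <= N * (5 * (K ^+ n * l%:R)).
  do 3 (apply: mulr_ge0 => //); exact/exprn_ge0/(le_trans ler01).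
have step (a b c s t0 t1 t2 t3 t4 : C) (l n : nat) :
    cmod a <= r -> cmod b <= r -> cmod s <= r ->
    l%:R * t0 + a * t1 + 2 * b * t2 + s * t3 + 3 * 'i / 2 * t4 = 0 ->
    l%:R * cmod t0 <= N * (5 * (K ^+ n.+1 * ((n.+2 %/ 3)`!)%:R)) ->
    cmod t1 <= N * growth K n -> cmod t2 <= N * growth K n.+1 ->
    cmod t3 <= N * growth K n.+1 -> cmod t4 <= N * growth K n.+2.
  move=> ar br sr E h0 h1 h2 h3.
  have E4 : 3 * 'i / 2 * t4 = - (l%:R * t0 + a * t1 + 2 * b * t2 + s * t3).
    by apply/eqP; rewrite -addr_eq0 addrC E.
  have : cmod (3 * 'i / 2 * t4) <= N * (5 * (K ^+ n.+1 * ((n.+2 %/ 3)`!)%:R)) +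
     r * (N * growth K n) + 2 * r * (N * growth K n.+1) + r * (N * growth K n.+1).
    rewrite E4 cmodN; apply: cmodD_le; last exact: M1.
    apply: cmodD_le; last exact: (M1 _ _ _ _ (M1 _ _ _ _ n2 br) h2).
    apply: cmodD_le; last exact: M1.
    by rewrite cmodM cmod_nat.
  rewrite cmodM i3.
  have g1 := @growth_le R K n n.+2 n.+1 K1 (leqnSn n) (leqW (leqnSn n)).
  have g2 := @growth_le R K n.+1 n.+2 n.+1 K1 (leqnn _) (leqnSn _).
  set U := K ^+ n.+1 * _ in g1 g2 *.
  have -> : growth K n.+2 = K * U by rewrite /growth exprS mulrA.
  have := ler_wpM2l (mulr_ge0 r0 N0) g1; have := ler_wpM2l (mulr_ge0 r0 N0) g2.
  have -> : N * (K * U) = N * (5 * U) + 4 * (r * N * U) by rewrite /K; ring.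
  have := cmod_ge0 t4; lra.
move=> j k; move: {2}(j + k)%N (leqnn (j + k)) => n.
elim: n j k => [|n IH] j k jkn.
  have -> : j = 0%N by move: jkn; clear; lia.
  have -> : k = 0%N by move: jkn; clear; lia.
  by rewrite (le_trans (base _ _ _ _))// ler_peMr// growth_ge1.
have [jk|jk] := leqP (j + k) n; first exact: IH.
case: j jkn jk => [|[|j]] jkn jk.
- case: k jkn jk => [|[|k]] jkn jk.
  + by rewrite (le_trans (base _ _ _ _))// ler_peMr// growth_ge1.
  + by rewrite (le_trans (base _ _ _ _))// ler_peMr// growth_ge1.
  + have nk : n = k.+1 by move: jkn jk; clear; lia. subst n.
    apply: (step _ _ _ _ _ _ _ _ _ k k hb hd hs (I2 0%N k)) => //.
    (* For [k = 0] the moment at [k.-1] is a default value, weighted by 0. *)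
    * case: k IH {jkn jk} => [|k] IH /=.
        by rewrite mul0r U0.
      have h := IH 0%N k (leqW (leqnSn k)).
      rewrite add0n in h.
      apply: le_trans (ler_wpM2l (ler0n _ _) h) _.
      rewrite mulrCA ler_wpM2l//.
      apply: growth_rec3 => //; clear; lia.
    * by apply: (IH 0%N k); clear; lia.
    * by apply: (IH 0%N k.+1); clear; lia.
    * by apply: (IH 1%N k); clear; lia.
- case: k jkn jk => [|[|k]] jkn jk.
  + by rewrite (le_trans (base _ _ _ _))// ler_peMr// growth_ge1.
  + by rewrite (le_trans (base _ _ _ _))// ler_peMr// growth_ge1.
  + have nk : n = k.+2 by move: jkn jk; clear; lia. subst n.
    apply: (step _ _ _ _ _ _ _ _ _ k k.+1 hb hd hs (I2 1%N k)) => //.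
    * case: k IH {jkn jk} => [|k] IH /=.
        by rewrite mul0r U0.
      have h := IH 1%N k ltac:(clear; lia).
      apply: le_trans (ler_wpM2l (ler0n _ _) h) _.
      rewrite mulrCA ler_wpM2l//.
      apply: growth_rec3 => //; clear; lia.
    * by apply: (IH 1%N k); clear; lia.
    * by apply: (IH 1%N k.+1); clear; lia.
    * by apply: (IH 2%N k); clear; lia.
- have nk : n = (j + k).+1 by move: jkn jk; clear; lia. subst n.
  apply: (step _ _ _ _ _ _ _ _ _ j (j + k)%N ha hc hs (I1 j k)) => //.
  + case: j IH {jkn jk} => [|j] IH /=.
      by rewrite mul0r U0.
    have h := IH j k ltac:(clear; lia).
    apply: le_trans (ler_wpM2l (ler0n _ _) h) _.
    rewrite mulrCA ler_wpM2l//.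
    apply: growth_rec3 => //; clear; lia.
  + by apply: (IH j k); clear; lia.
  + by apply: (IH j.+1 k); clear; lia.
  + by have := IH j k.+1 ltac:(clear; lia); rewrite addnS.
Qed.

(** Each application of [mulq y] has five terms with coefficients at most [rho], and raises the
    degree by at most 2. *)
Lemma mulq_iter_growth (m : nat -> nat -> C) y (rho N K : R) n j k :
  0 <= N -> 1 <= K -> cbound rho y ->
  (forall j k, cmod (m j k) <= N * growth K (j + k)) ->
  cmod (iter n (mulq y) m j k) <= (5 * rho) ^+ n * (N * growth K (2 * n + (j + k))).
Proof.
move=> N0 K1 [ha hb hc hd hs] hm; elim: n j k => [|n IH] j k.
  by rewrite expr0 mul1r muln0 add0n; exact: hm.
have r0 : 0 <= rho := le_trans (cmod_ge0 _) ha.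
set G := growth K _.
have H j' k' (w : C) : (j' + k' <= j + k + 2)%N -> cmod w <= rho ->
    cmod (w * iter n (mulq y) m j' k') <= rho * ((5 * rho) ^+ n * (N * G)).
  move=> jk hw; rewrite cmodM ler_pM ?cmod_ge0//.
  rewrite (le_trans (IH _ _))// ler_wpM2l ?exprn_ge0 ?mulr_ge0//.
  rewrite ler_wpM2l// growth_mono//; move: jk; clear; lia.
rewrite iterS /mulq.
apply: le_trans (cmodD_le (cmodD_le (cmodD_le (cmodD_le (H _ _ _ _ ha)
  (H _ _ _ _ hb)) (H _ _ _ _ hc)) (H _ _ _ _ hd)) (H _ _ _ _ hs)) _; try by clear; lia.
by rewrite le_eqVlt exprS; apply/orP; left; apply/eqP; ring.
Qed.

End MomentBounds.

(** * Bounds and Taylor's formula uniform in the damping *)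

Section UniformBounds.
Variable R : realType.
Local Notation C := R[i].
Implicit Types (x y : coef R) (m : nat -> nat -> C).

Lemma cadd_path (t h : R) x y : cadd (t + h)%:C x y = cadd h%:C (cadd t%:C x y) y.
Proof. by rewrite caddA rmorphD. Qed.

Lemma conjcD (z w : C) : (z + w)^*%C = z^*%C + w^*%C.
Proof. exact: (rmorphD (@conjc R)). Qed.

Lemma conjcMr (t : R) (z : C) : (t%:C * z)^*%C = t%:C * z^*%C.
Proof. by rewrite [LHS](rmorphM (@conjc R)) /= oppr0. Qed.

Lemma admissible_cadd (e d t : R) x y : admissible e x -> admissible d y ->
  admissible (e + t * d) (cadd t%:C x y).
Proof.
move=> [h1 h2] [k1 k2]; split => /=.
  by rewrite h1 k1 conjcD conjcMr; ring.
by rewrite ReD ReMr h2 k2; ring.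
Qed.

Lemma cbound_cadd (r rho t : R) x y : 0 <= t <= 1 -> cbound r x -> cbound rho y ->
  cbound (r + rho) (cadd t%:C x y).
Proof.
move=> /andP[t0 t1] [h1 h2 h3 h4 h5] [k1 k2 k3 k4 k5].
have H (z w : C) : cmod z <= r -> cmod w <= rho -> cmod (z + t%:C * w) <= r + rho.
  move=> zr wr; apply: cmodD_le => //; rewrite cmodM cmod_real ger0_norm//.
  by rewrite (le_trans _ wr)// ler_piMl ?cmod_ge0.
by split; apply: H.
Qed.

Lemma mulq_iter_qder (M : R -> nat -> nat -> C) (M' : nat -> nat -> C) y n j k :
  (forall j k, qder (fun h => M h j k) (M' j k)) ->
  qder (fun h => iter n (mulq y) (M h) j k) (iter n (mulq y) M' j k).
Proof.
move=> HM; elim: n j k => [|n IH] j k; first exact: HM.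
rewrite iterS; apply: qder_eq (qderD (qderD (qderD (qderD
  (qderZ (ca y) (IH j.+1 k)) (qderZ (cb y) (IH j k.+1))) (qderZ (cc y) (IH j.+2 k)))
  (qderZ (cd y) (IH j k.+2))) (qderZ (cs y) (IH j.+1 k.+1))) _ _ => [h|//].
by rewrite iterS.
Qed.

Lemma qder_is_cderive (g : R -> C) (t : R) (l : C) :
  qder (fun h => g (t + h)) l -> is_cderive g t l.
Proof.
move=> [B [d [d0 H]]]; apply: (is_cderive_quadratic (B := B) d0) => h /H.
by rewrite addr0.
Qed.

Lemma mom_path_cderive (e d t : R) x y n j k : admissible e x -> admissible d y ->
  0 < e + t * d ->
  is_cderive (fun t => iter n (mulq y) (mom (cadd t%:C x y)) j k) t
    (iter n.+1 (mulq y) (mom (cadd t%:C x y)) j k).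
Proof.
move=> ax ay et; apply: qder_is_cderive.
rewrite iterSr; under [X in qder X]eq_fun do rewrite cadd_path.
apply: mulq_iter_qder => {}j {}k.
exact: mom_deriv et (admissible_cadd t ax ay).
Qed.

Lemma mom_base (r : R) j k : exists N : R, 0 <= N /\
  forall x, admissible 1 x -> cbound r x -> cmod (mom x j k) <= N.
Proof.
have e2 : 0 < (1 / 2 : R) by rewrite divr_gt0.
have [N [N0 H]] := osc_bound (2 * r ^+ 2 / 1) e2 (tempered_mon R j k).
exists N; split => // x ax [ha hb _ _ _]; apply: H.
exact: phase_ph.
Qed.

Lemma ler_term_sum (I : finType) (F : I -> R) i :
  (forall j, 0 <= F j) -> F i <= \sum_j F j.
Proof. by move=> F0; rewrite (bigD1 i)// lerDl sumr_ge0. Qed.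

Lemma ler_norm_of_sqr (t M : R) : t ^+ 2 <= M -> `|t| <= 1 + M.
Proof.
rewrite -(real_normK (num_real t)).
have := sqr_ge0 (`|t| - 1); have := normr_ge0 t; nra.
Qed.

(** Along a path lowering the damping from 1 to [e], the derivative of the moment [(j, k)] is
    [1 - e] times the moment [(j.+1, k.+1)]. For [j, k <= 1], [ibp_growth] bounds it by the four
    base moments with a constant free of [e], and Gronwall applies. A second use of [ibp_growth]
    reaches all degrees. *)
Lemma mom_uniform (r : R) : exists N : R, 0 <= N /\
  forall (e : R) x, 0 < e <= 1 -> admissible e x -> cbound r x ->
  forall j k, cmod (mom x j k) <= N * growth (5 + 4 * r) (j + k).
Proof.
(* For [r < 0] no coefficients satisfy [cbound r]. *)
have [r0|r0] := ltP r 0.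
  exists 0; split => // e x _ _ [h _ _ _ _].
  by have := le_trans (cmod_ge0 _) h; rewrite leNgt r0.
(* The radius is [r + 1] because [cs x] moves by at most 1 along the path. *)
have [b0 [b00 B0]] := mom_base (r + 1) 0 0.
have [b1 [b10 B1]] := mom_base (r + 1) 0 1.
have [b2 [b20 B2]] := mom_base (r + 1) 1 0.
have [b3 [b30 B3]] := mom_base (r + 1) 1 1.
pose N0 := b0 + b1 + b2 + b3.
have N00 : 0 <= N0 by rewrite !addr_ge0.
have n0 : b0 <= N0 by rewrite /N0; move: b10 b20 b30; clear; lra.
have n1 : b1 <= N0 by rewrite /N0; move: b00 b20 b30; clear; lra.
have n2 : b2 <= N0 by rewrite /N0; move: b00 b10 b30; clear; lra.
have n3 : b3 <= N0 by rewrite /N0; move: b00 b10 b20; clear; lra.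
pose bn (b : bool) : nat := b.
(* 4 is the largest degree of [(j.+1, k.+1)] with [j, k <= 1]. *)
pose G := growth (5 + 4 * (r + 1)) 4.
have K1 : 1 <= 5 + 4 * (r + 1) :> R by lra.
have G0 : 0 <= G by exact: growth_ge0.
(* Eight real functions: the real and imaginary parts of the four base moments. *)
pose I : finType := (bool * bool * bool)%type.
have cI : #|I| = 8%N by rewrite !card_prod card_bool.
(* The 2 adds real and imaginary parts; [1 + M] bounds [|t|] when [t^2 <= M]. *)
pose N := 2 * (1 + expR (2 * G * #|I|%:R) * (#|I|%:R * N0 ^+ 2)).
have NN0 : 0 <= N by rewrite !(mulr_ge0, addr_ge0)// ?expR_ge0 ?exprn_ge0.
exists N; split => // e x /andP[e0 e1] ax xr.
have ibp := fun j k => ibp_mom j k e0 ax.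
apply: (ibp_growth NN0 xr) => [j k|j k|]; [by have [] := ibp j k|by have [] := ibp j k|].
(* The path [x0 + t y] has damping 1 at [t = 0] and arrives at [x], with damping [e], at [t = 1]. *)
pose y : coef R := Coef 0 0 0 0 (1 - e)%:C.
pose x0 := cadd (-1) x y.
have ay : admissible (e - 1) y by split => /=; rewrite ?rmorph0 ?oppr0 ?opprB.
have ax0 : admissible 1 x0.
  have := admissible_cadd (-1) ax ay; rewrite rmorphN1 /x0.
  by rewrite (_ : e + -1 * (e - 1) = 1)//; ring.
have x1E : cadd 1%:C x0 y = x.
  by rewrite /x0 /cadd/= !mulr0 !addr0 mul1r mulN1r subrK; case: (x).
have xtE (t : R) : cadd t%:C x0 y = Coef (ca x) (cb x) (cc x) (cd x)
    (cs x + ((t - 1) * (1 - e))%:C).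
  by rewrite /x0 /cadd/= !mulr0 !addr0 rmorphM rmorphB/=; congr Coef; ring.
have xtr (t : R) : 0 <= t <= 1 -> cbound (r + 1) (cadd t%:C x0 y).
  rewrite xtE => /andP[t0 t1]; have [h1 h2 h3 h4 h5] := xr.
  split => /=; rewrite ?(le_trans h1) ?(le_trans h2) ?(le_trans h3) ?(le_trans h4) ?lerDl//.
  apply: cmodD_le => //; rewrite cmod_real ler_norml; nra.
have axt (t : R) : admissible (1 + t * (e - 1)) (cadd t%:C x0 y).
  exact: admissible_cadd.
have et (t : R) : 0 <= t <= 1 -> 0 < 1 + t * (e - 1) <= 1.
  move=> /andP[t0 t1]; apply/andP; split; nra.
pose f (i : I) (t : R) : R :=
  let z := mom (cadd t%:C x0 y) (bn i.1.1) (bn i.1.2) in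
  if i.2 then complex.Re z else complex.Im z.
pose df (i : I) (t : R) : R :=
  let z := mulq y (mom (cadd t%:C x0 y)) (bn i.1.1) (bn i.1.2) in
  if i.2 then complex.Re z else complex.Im z.
have fd i (t : R) : 0 <= t <= 1 -> is_derive t 1 (f i) (df i t).
  move=> t01; have /andP[e't _] := et t t01.
  have [hR hI] := mom_path_cderive 0 (bn i.1.1) (bn i.1.2) ax0 ay e't.
  by rewrite /f /df; case: i.2.
have fsum (b c : bool) (t : R) : cmod (mom (cadd t%:C x0 y) (bn b) (bn c)) <=
    \sum_i `|f i t|.
  rewrite (le_trans (cmod_le_ReIm _))//.
  rewrite (bigD1 ((b, c), true))// lerD//.
  by rewrite (bigD1 ((b, c), false))/= ?xpair_eqE ?andbF// lerDl sumr_ge0.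
have dfG i (t : R) : 0 <= t <= 1 -> `|df i t| <= G * \sum_j `|f j t|.
  move=> t01; have /andP[e't _] := et t t01.
  have ibp' := fun j k => ibp_mom j k e't (axt t).
  have s0 : 0 <= \sum_j `|f j t| by apply: sumr_ge0.
  have hm : cmod (mom (cadd t%:C x0 y) (bn i.1.1).+1 (bn i.1.2).+1) <=
      (\sum_j `|f j t|) * growth (5 + 4 * (r + 1)) ((bn i.1.1).+1 + (bn i.1.2).+1).
    apply: (ibp_growth s0 (xtr t t01)) => [j k|j k|j k j1 k1];
      [by have [] := ibp' j k|by have [] := ibp' j k|].
    have := fsum (j == 1%N) (k == 1%N) t.
    by case: j j1 => [|[|//]] _; case: k k1 => [|[|//]] _.
  apply: (@le_trans _ _ (cmod (mulq y (mom (cadd t%:C x0 y)) (bn i.1.1) (bn i.1.2)))).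
    by rewrite /df; case: i.2; [exact: ler_Re_cmod|exact: ler_Im_cmod].
  rewrite /mulq/= !mul0r !add0r cmodM cmod_real ger0_norm ?subr_ge0//.
  apply: (@le_trans _ _ (1 * ((\sum_j `|f j t|) * growth (5 + 4 * (r + 1))
     ((bn i.1.1).+1 + (bn i.1.2).+1)))).
    apply: ler_pM; rewrite ?subr_ge0 ?cmod_ge0//; lra.
  rewrite mul1r mulrC ler_wpM2r// growth_mono//.
  by case: i.1.1; case: i.1.2.
have := gronwall G0 fd dfG.
have f00 i : f i 0 ^+ 2 <= N0 ^+ 2.
  have H : cmod (mom (cadd 0%:C x0 y) (bn i.1.1) (bn i.1.2)) <= N0.
    have a0 : admissible 1 (cadd 0%:C x0 y) by rewrite rmorph0 cadd0.
    have r1 : cbound (r + 1) (cadd 0%:C x0 y) by apply: xtr; rewrite lexx ler01.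
    have := (B0 _ a0 r1, B1 _ a0 r1, B2 _ a0 r1, B3 _ a0 r1) => -[[[h0 h1] h2] h3].
    by case: i.1.1; case: i.1.2;
      [exact: le_trans h3 n3|exact: le_trans h2 n2|exact: le_trans h1 n1|exact: le_trans h0 n0].
  rewrite -(real_normK (num_real (f i 0))) lerXn2r ?nnegrE//.
  by rewrite (le_trans _ H)// /f; case: i.2; [exact: ler_Re_cmod|exact: ler_Im_cmod].
move=> h1 j k j1 k1.
have h2 : \sum_i f i 1 ^+ 2 <= expR (2 * G * #|I|%:R) * (#|I|%:R * N0 ^+ 2).
  rewrite (le_trans h1)// ler_wpM2l ?expR_ge0//.
  by rewrite (le_trans (ler_sum _ (fun i _ => f00 i)))// sumr_const mulr_natl.
have f1 i : `|f i 1| <= 1 + expR (2 * G * #|I|%:R) * (#|I|%:R * N0 ^+ 2).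
  apply: ler_norm_of_sqr; apply: le_trans h2.
  exact: (ler_term_sum (F := fun i => f i 1 ^+ 2) i (fun i => sqr_ge0 (f i 1))).
rewrite (le_trans (cmod_le_ReIm _))// /N mulrDl mul1r.
have := f1 ((j == 1%N, k == 1%N), true); have := f1 ((j == 1%N, k == 1%N), false).
rewrite /f/= x1E.
case: j j1 => [|[|//]] _; case: k k1 => [|[|//]] _; rewrite /bn /=; move=> ? ?; exact: lerD.
Qed.

Lemma segment_range (e d t : R) : 0 < e <= 1 -> 0 < e + d <= 1 ->
  0 <= t <= 1 -> 0 < e + t * d <= 1.
Proof.
move=> /andP[e0 e1] /andP[d0 d1] /andP[t0 t1].
have [dp|dn] := lerP 0 d; apply/andP; split; nra.
Qed.

(** The direction [y] may change the damping, by [d]: a nonzero [d] gives the Lipschitz dependence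
    on the damping behind [mom_rlim], and [d = 0] the expansions that pass to the limit. *)
Lemma mom_taylor (r : R) : exists N : R, 0 <= N /\
  forall (e d r1 rho : R) x y j k n, admissible e x -> admissible d y ->
  0 < e <= 1 -> 0 < e + d <= 1 -> cbound r1 x -> cbound rho y -> r1 + rho <= r ->
  cmod (mom (cadd 1 x y) j k -
    \sum_(m < n.+1) iter m (mulq y) (mom x) j k / m`!%:R) <=
  2 * ((5 * rho) ^+ n.+1 * (N * growth (5 + 4 * r) (2 * n.+1 + (j + k)))) / n`!%:R.
Proof.
have [N [N0 HN]] := mom_uniform r.
exists N; split => // e d r1 rho x y j k n ax ay e01 d01 xr yr rr.
have r0 : 0 <= r.
  have [h _ _ _ _] := xr; have [h' _ _ _ _] := yr.
  have := cmod_ge0 (ca x); have := cmod_ge0 (ca y); lra.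
have K1 : 1 <= 5 + 4 * r by lra.
have := @taylor_complex R (fun (m : nat) (t : R) => iter m (mulq y) (mom (cadd t%:C x y)) j k) n
  ((5 * rho) ^+ n.+1 * (N * growth (5 + 4 * r) (2 * n.+1 + (j + k)))).
rewrite rmorph0 rmorph1 cadd0; apply=> [m t t01|t t01].
  by apply: mom_path_cderive ax ay _; have /andP[] := segment_range e01 d01 t01.
apply: mulq_iter_growth => // {}j {}k.
apply: HN (admissible_cadd t ax ay) _ j k; first exact: segment_range.
have [h1 h2 h3 h4 h5] := cbound_cadd t01 xr yr.
by split; rewrite (le_trans _ rr).
Qed.

End UniformBounds.

(** * Limits at damping 0 with a linear rate *)

Section RegularizedLimit.
Variable R : realType.
Local Notation C := R[i].
Implicit Types (g : R -> C) (l : C).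

(** The rate that Lipschitz dependence on the damping provides. Fixing it makes sums, products and
    perturbations of order [e] elementary; [rlim_cvg] returns to filters. *)
Definition rlim g l := exists K : R,
  forall e : R, 0 < e <= 1 -> cmod (g e - l) <= K * e.

Lemma rlim_cst l : rlim (fun=> l) l.
Proof. by exists 0 => e _; rewrite subrr cmod0 mul0r. Qed.

Lemma rlimD g g' l l' : rlim g l -> rlim g' l' -> rlim (fun e => g e + g' e) (l + l').
Proof.
move=> [K H] [K' H']; exists (K + K') => e e01.
rewrite mulrDl (_ : _ - _ = (g e - l) + (g' e - l')); last by ring.
by apply: cmodD_le; [exact: H|exact: H'].
Qed.

Lemma rlim_bounded g l : rlim g l -> exists M, 0 <= M /\
  forall e : R, 0 < e <= 1 -> cmod (g e) <= M.
Proof.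
move=> [K H]; exists (`|K| + cmod l); split => [|e e01].
  by rewrite addr_ge0 ?cmod_ge0.
rewrite (_ : g e = (g e - l) + l); last by ring.
apply: cmodD_le => //; rewrite (le_trans (H e e01))//.
case/andP: e01 => e0 e1; rewrite (le_trans (ler_wpM2r (ltW e0) (ler_norm K)))//.
by rewrite ler_piMr.
Qed.

Lemma rlimM g g' l l' : rlim g l -> rlim g' l' -> rlim (fun e => g e * g' e) (l * l').
Proof.
move=> hg [K' H']; have [M [M0 HM]] := rlim_bounded hg; have [K H] := hg.
exists (M * K' + K * cmod l') => e e01.
rewrite mulrDl (_ : _ - _ = g e * (g' e - l') + (g e - l) * l'); last by ring.
apply: cmodD_le.
  by rewrite cmodM -mulrA ler_pM ?cmod_ge0 ?HM ?H'.
by rewrite cmodM mulrAC ler_wpM2r ?cmod_ge0 ?H.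
Qed.

Lemma rlimZ g l (c : C) : rlim g l -> rlim (fun e => c * g e) (c * l).
Proof. exact/rlimM/rlim_cst. Qed.

Lemma rlim_sum (I : Type) (r : seq I) (G : I -> R -> C) (L : I -> C) :
  (forall i, rlim (G i) (L i)) ->
  rlim (fun e => \sum_(i <- r) G i e) (\sum_(i <- r) L i).
Proof.
move=> H; elim: r => [|i r IH].
  by rewrite big_nil; under [X in rlim X]eq_fun do rewrite big_nil; exact: rlim_cst.
rewrite big_cons; under [X in rlim X]eq_fun do rewrite big_cons.
exact: rlimD.
Qed.

Lemma rlim_le g l M : rlim g l ->
  (forall e : R, 0 < e <= 1 -> cmod (g e) <= M) -> cmod l <= M.
Proof.
move=> [K H] gM; apply/ler_addgt0Pr => d d0.
have K1 : 0 < `|K| + 1 by rewrite ltr_wpDl.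
pose e := Num.min 1 (d / (`|K| + 1)).
have e0 : 0 < e by rewrite lt_min ltr01 divr_gt0.
have e01 : 0 < e <= 1 by rewrite e0 /e ge_min lexx.
rewrite (_ : l = g e - (g e - l)); last by ring.
rewrite (le_trans (cmodB _ _))// lerD ?gM// (le_trans (H e e01))//.
have : e * (`|K| + 1) <= d by rewrite -ler_pdivlMr// /e ge_min lexx orbT.
have := ler_norm K; nra.
Qed.

Lemma rlim_unique g l l' : rlim g l -> rlim g l' -> l = l'.
Proof.
move=> h h'; apply/eqP; rewrite -subr_eq0; apply/eqP/cmod_eq0/eqP.
rewrite eq_le cmod_ge0 andbT.
rewrite -mulN1r; apply: rlim_le (rlimD h (rlimZ (-1) h')) _ => e _.
by rewrite mulN1r subrr cmod0.
Qed.

Lemma rlim_close g g' l K : rlim g l ->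
  (forall e : R, 0 < e <= 1 -> cmod (g' e - g e) <= K * e) -> rlim g' l.
Proof.
move=> [M H] H'; exists (K + M) => e e01.
rewrite mulrDl (_ : g' e - l = (g' e - g e) + (g e - l)); last by ring.
by apply: cmodD_le; [exact: H'|exact: H].
Qed.

Lemma rlim_lipschitz g (K : R) :
  (forall s t : R, 0 < s <= 1 -> 0 < t <= 1 -> cmod (g s - g t) <= K * `|s - t|) ->
  exists l, rlim g l.
Proof.
move=> gK.
have [u hu] : exists u, forall s : R, 0 < s <= 1 -> `|complex.Re (g s) - u| <= K * s.
  apply: lipschitz_limit0 => s t s01 t01; apply: le_trans (gK s t s01 t01).
  by rewrite -ReN -ReD ler_Re_cmod.
have [v hv] : exists v, forall s : R, 0 < s <= 1 -> `|complex.Im (g s) - v| <= K * s.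
  apply: lipschitz_limit0 => s t s01 t01; apply: le_trans (gK s t s01 t01).
  by rewrite -ImN -ImD ler_Im_cmod.
exists (u +i* v), (K + K) => e e01.
by rewrite mulrDl (le_trans (cmod_le_ReIm _))// ReD ImD lerD ?hu ?hv.
Qed.

Lemma rlim_cvg (g : R -> R[i]^o) l : rlim g l -> g e @[e --> 0^'+] --> (l : R[i]^o).
Proof.
move=> [K H]; apply/cvgrPdist_le => /= d d0.
have := d0; rewrite ltcE/= => /andP[/eqP dI dR].
have K1 : 0 < `|K| + 1 by rewrite ltr_wpDl.
near=> e.
have e0 : 0 < e by near: e; exact: nbhs_right_gt.
have em : e <= Num.min 1 (complex.Re d / (`|K| + 1)).
  near: e; apply: nbhs_right_le; rewrite lt_min ltr01 divr_gt0//.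
move: em; rewrite le_min ler_pdivlMr// => /andP[e1 ed].
rewrite distrC -cmod_norm lecE/= dI eqxx/=.
rewrite (le_trans (H e _)) ?e0//.
have := ler_norm K; nra.
Unshelve. all: by end_near. Qed.

Lemma cvgn_cmod (u : nat -> R[i]^o) (l : C) :
  (forall e : R, 0 < e -> exists N : nat, forall n, (N <= n)%N -> cmod (u n - l) <= e) ->
  u n @[n --> \oo] --> (l : R[i]^o).
Proof.
move=> H; apply/cvgrPdist_le => /= d d0.
have := d0; rewrite ltcE/= => /andP[/eqP dI dR].
have [N HN] := H _ dR; exists N => // n /= Nn.
by rewrite distrC -cmod_norm lecE/= dI eqxx/= HN.
Qed.

End RegularizedLimit.

(** * Moments at damping 0 *)

Section LimitMoments.
Variable R : realType.
Local Notation C := R[i].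
Implicit Types (x y : coef R).

Definition reg (e : R) x := Coef (ca x) (cb x) (cc x) (cd x) (cs x - e%:C).

Lemma admissible_reg (e : R) x : admissible 0 x -> admissible e (reg e x).
Proof. by move=> [h1 h2]; split => //=; rewrite ReD ReN/= h2 oppr0 add0r. Qed.

Lemma cbound_reg (e r : R) x : 0 < e <= 1 -> cbound r x -> cbound (r + 1) (reg e x).
Proof.
move=> /andP[e0 e1] [h1 h2 h3 h4 h5].
split => /=; rewrite ?(le_trans h1) ?(le_trans h2) ?(le_trans h3) ?(le_trans h4) ?lerDl//.
by apply: cmodD_le => //; rewrite cmodN cmod_real ger0_norm// ltW.
Qed.

Lemma reg_cadd (e : R) x y : reg e (cadd 1 x y) = cadd 1 (reg e x) y.
Proof. by rewrite /reg /cadd/= -!addrA (addrC _ (- _)). Qed.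

Lemma mom_rlim x j k : admissible 0 x -> exists l, rlim (fun e => mom (reg e x) j k) l.
Proof.
move=> ax; have [r [r0 xr]] := cbound_ex x.
have [N [N0 HN]] := mom_taylor (r + 2).
apply: (@rlim_lipschitz _ _ (2 * (5 * (N * growth (5 + 4 * (r + 2)) (2 * 1 + (j + k)))))).
move=> s t s01 t01.
(* The direction that takes the damping from [t] to [s]; its size [|s - t|] appears to the first
   power in the remainder of order 0. *)
pose y : coef R := Coef 0 0 0 0 (t - s)%:C.
have ay : admissible (s - t) y by split => /=; rewrite ?rmorph0 ?oppr0 ?opprB.
have yr : cbound `|s - t| y by split; rewrite /= ?cmod0// cmod_real distrC.
have st : 0 < t + (s - t) <= 1 by rewrite addrC subrK.
have st1 : `|s - t| <= 1 by rewrite ler_norml; lra.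
have rr : r + 1 + `|s - t| <= r + 2 by lra.
have := HN t (s - t) (r + 1) `|s - t| (reg t x) y j k 0%N (admissible_reg t ax) ay
  t01 st (cbound_reg t01 xr) yr rr.
rewrite big_ord1/= fact0 !divr1 expr1.
have -> : cadd 1 (reg t x) y = reg s x.
  by rewrite /cadd /reg/= !mulr0 !addr0 mul1r rmorphB/=; congr Coef; ring.
by move=> h; apply: le_trans h _; rewrite le_eqVlt; apply/orP; left; apply/eqP; ring.
Qed.

(** The default 0 is not reached for [x] admissible with damping 0, by [mom0P]. *)
Definition mom0 x (j k : nat) : C :=
  xget 0 [set l | rlim (fun e => mom (reg e x) j k) l].

Lemma mom0P x j k : admissible 0 x -> rlim (fun e => mom (reg e x) j k) (mom0 x j k).
Proof. by move=> /(mom_rlim j k)[l hl]; exact: (xgetI 0 hl). Qed.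

Lemma mulq_rlim (M : R -> nat -> nat -> C) (m : nat -> nat -> C) y j k :
  (forall j k, rlim (fun e => M e j k) (m j k)) ->
  rlim (fun e => mulq y (M e) j k) (mulq y m j k).
Proof. by move=> HM; do 4 (apply: rlimD; last exact: rlimZ); exact: rlimZ. Qed.

Lemma mulq_iter_rlim (M : R -> nat -> nat -> C) (m : nat -> nat -> C) y n j k :
  (forall j k, rlim (fun e => M e j k) (m j k)) ->
  rlim (fun e => iter n (mulq y) (M e) j k) (iter n (mulq y) m j k).
Proof.
by move=> HM; elim: n j k => [|n IH] j k; [exact: HM|exact: mulq_rlim].
Qed.

Lemma admissible0_cadd x y : admissible 0 x -> admissible 0 y -> admissible 0 (cadd 1 x y).
Proof.
by move=> ax ay; have := admissible_cadd 1 ax ay; rewrite rmorph1 mulr0 addr0.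
Qed.

Lemma mom0_taylor (r : R) : exists N : R, 0 <= N /\
  forall (r1 rho : R) x y j k n, admissible 0 x -> admissible 0 y ->
  cbound r1 x -> cbound rho y -> r1 + rho <= r ->
  cmod (mom0 (cadd 1 x y) j k -
    \sum_(m < n.+1) iter m (mulq y) (mom0 x) j k / m`!%:R) <=
  2 * ((5 * rho) ^+ n.+1 * (N * growth (5 + 4 * (r + 1)) (2 * n.+1 + (j + k)))) / n`!%:R.
Proof.
have [N [N0 HN]] := mom_taylor (r + 1).
exists N; split => // r1 rho x y j k n ax ay xr yr rr.
have axy := admissible0_cadd ax ay.
have h1 := mom0P j k axy.
have h2 : rlim (fun e => \sum_(m < n.+1) m`!%:R^-1 * iter m (mulq y) (mom (reg e x)) j k)
    (\sum_(m < n.+1) m`!%:R^-1 * iter m (mulq y) (mom0 x) j k).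
  by apply: rlim_sum => m; apply: rlimZ; apply: mulq_iter_rlim => ? ?; exact: mom0P.
under eq_bigr do rewrite mulrC.
rewrite -mulN1r; apply: rlim_le (rlimD h1 (rlimZ (-1) h2)) _ => e e01.
rewrite mulN1r reg_cadd; under eq_bigr do rewrite mulrC.
apply: (HN e 0 (r1 + 1) rho) => //.
- exact: admissible_reg.
- by rewrite addr0.
- exact: cbound_reg.
- lra.
Qed.

Definition cscale (h : C) y :=
  Coef (h * ca y) (h * cb y) (h * cc y) (h * cd y) (h * cs y).

Lemma mulq_cscale (h : C) y (m : nat -> nat -> C) j k :
  mulq (cscale h y) m j k = h * mulq y m j k.
Proof. by rewrite /mulq/= -!mulrA -!mulrDr. Qed.

(** Taylor's formula of order 1 in the direction [h y], whose size [|h| s] enters the remainder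
    squared. *)
Lemma mom0_deriv x y j k : admissible 0 x -> admissible 0 y ->
  qder (fun h => mom0 (cadd h%:C x y) j k) (mulq y (mom0 x) j k).
Proof.
move=> ax ay; have [r [r0 xr]] := cbound_ex x; have [s [s0 ys]] := cbound_ex y.
have [N [N0 HN]] := mom0_taylor (r + s).
exists (2 * ((5 * s) ^+ 2 * (N * growth (5 + 4 * (r + s + 1)) (2 * 2 + (j + k))))), 1.
split => // h h1.
pose yh := cscale h%:C y.
have ayh : admissible 0 yh.
  case: ay => k1 k2; split => /=; first by rewrite k1 conjcMr mulrN.
  by rewrite ReMr k2 oppr0 mulr0.
have yhs : cbound (`|h| * s) yh.
  by case: ys => k1 k2 k3 k4 k5; split => /=; rewrite cmodM cmod_real ler_wpM2l.
have rr : r + `|h| * s <= r + s by rewrite lerD2l ler_piMl// ltW.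
have := HN r (`|h| * s) x yh j k 1%N ax ayh xr yhs rr.
have -> : cadd 1 x yh = cadd h%:C x y by rewrite /cadd/= !mul1r.
rewrite !big_ord_recl big_ord0 /= /bump /= !fact0 !divr1 addr0 rmorph0 cadd0.
rewrite mulq_cscale opprD addrA => hh; apply: le_trans hh _.
have -> : (5 * (`|h| * s)) ^+ 2 = (5 * s) ^+ 2 * h ^+ 2.
  by rewrite -(real_normK (num_real h)) !exprMn mulrA mulrAC.
by move: ((5 * s) ^+ 2) (N * _) (h ^+ 2) => u v w; rewrite -[leRHS]mulrA [u * v * w]mulrAC.
Qed.

End LimitMoments.

(** * The umbilic integral as a moment, its partial derivatives, and the series *)

Section Umbilic.
Variable R : realType.
Local Notation C := R[i].
Implicit Types (x y z : R) (m : nat -> nat -> C).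

Lemma complexD (u v : R) : u +i* v = u%:C + 'i * v%:C :> C.
Proof.
by apply/eqP; rewrite eq_complex/= !(mul0r, mul1r, mulr0, subr0, addr0, add0r) !eqxx.
Qed.

Lemma half_i : 'i / 2 = 0 +i* (1 / 2) :> C.
Proof.
by rewrite (complexD 0) rmorph0 add0r fmorph_div/= rmorph1 rmorph_nat div1r.
Qed.

Lemma i_mul_i : 'i * 'i = -1 :> C.
Proof. by rewrite -expr2 sqr_i. Qed.

(* Lets [ring] and [field] use [i ^+ 2 = -1]. *)
Lemma i_ring (r p q : C) : p = q + ('i * 'i + 1) * r -> p = q.
Proof. by move=> ->; rewrite i_mul_i addNr mul0r addr0. Qed.

(** The linear part is [- i (x xi + y eta)], because [x xi + y eta] is the real part of
    [(x - i y) zeta]. *)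
Definition upar x y z : coef R :=
  Coef (- ('i / 2) * (x -i* y)) (- ('i / 2) * (x +i* y)) 0 0 (- 'i * z%:C).

Lemma admissible_upar x y z : admissible 0 (upar x y z).
Proof.
split => /=; first by rewrite !oppr0.
by rewrite !(mul0r, mulr0, oppr0, subr0).
Qed.

Lemma ph_reg_upar x y z (e : R) (p : R * R) : ph (reg e (upar x y z)) p =
  (- 'i * (x * p.1 + y * p.2)%:C
          - 'i * (z * (p.1 ^+ 2 + p.2 ^+ 2))%:C
          + 'i * (p.1 ^+ 3 - 3 * p.1 * p.2 ^+ 2)%:C)
    + - (e * (p.1 ^+ 2 + p.2 ^+ 2))%:C.
Proof.
case: p => u v /=.
have hl : - ('i / 2) * (x -i* y) * zeta (u, v) + - ('i / 2) * (x +i* y) * zetab (u, v)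
    = - 'i * (x * u + y * v)%:C.
  rewrite half_i; apply/eqP; rewrite eq_complex/=.
  by apply/andP; split; apply/eqP; field.
have hq : (- 'i * z%:C - e%:C) * (zeta (u, v) * zetab (u, v)) =
    - 'i * (z * (u ^+ 2 + v ^+ 2))%:C - (e * (u ^+ 2 + v ^+ 2))%:C.
  by rewrite -sqnorm_zeta /sqnorm/= !rmorphM/=; ring.
have hc : cubic (u, v) = 'i * (u ^+ 3 - 3 * u * v ^+ 2)%:C.
  rewrite /cubic half_i; apply/eqP; rewrite eq_complex !(exprS, expr0, mulr1)/=.
  by apply/andP; split; apply/eqP; field.
by rewrite /ph hc /quad /= hl !mul0r !addr0 hq; ring.
Qed.

Lemma umbilic_reg_mom x y z (e : R) :
  umbilic_reg x y z e = ((2 * pi)^-1)%:C * mom (reg e (upar x y z)) 0 0.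
Proof.
rewrite /umbilic_reg /mom /osc; congr (_ * cintegral2 _).
apply/funext => -[xi eta].
by rewrite ph_reg_upar -cexpD /mon !expr0 !mul1r.
Qed.

Let kpi : C := ((2 * pi)^-1)%:C.

Lemma umbilic_reg_cvg x y z :
  umbilic_reg x y z e @[e --> 0^'+] --> (kpi * mom0 (upar x y z) 0 0 : R[i]^o).
Proof.
have -> : umbilic_reg x y z = (fun e => kpi * mom (reg e (upar x y z)) 0 0).
  by apply/funext => e; exact: umbilic_reg_mom.
by apply: rlim_cvg; apply: rlimZ; apply: mom0P; exact: admissible_upar.
Qed.

Lemma umbilicE_mom0 x y z : umbilicE x y z = kpi * mom0 (upar x y z) 0 0.
Proof. exact: (cvg_lim (@norm_hausdorff R[i] R[i]^o) (@umbilic_reg_cvg x y z)). Qed.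

(** The head of the list acts first: differentiating [mom0] inserts a new factor innermost, so a
    partial derivative becomes a cons. *)
Definition opl (l : seq (coef R)) m := foldl (fun m (d : coef R) => mulq d m) m l.

Lemma opl_qder (M : R -> nat -> nat -> C) (M' : nat -> nat -> C) l j k :
  (forall j k, qder (fun h => M h j k) (M' j k)) ->
  qder (fun h => opl l (M h) j k) (opl l M' j k).
Proof.
elim: l M M' j k => [|y l IH] M M' j k HM; first exact: HM.
by apply: IH => {}j {}k; exact: (@mulq_iter_qder _ M M' y 1 j k HM).
Qed.

(* [quad dirx] is [- i xi], [quad diry] is [- i eta], so that [mulq] along them
   realizes the partial derivatives in [x] and [y]. *)
Definition dirx : coef R := Coef (- ('i / 2)) (- ('i / 2)) 0 0 0.
Definition diry : coef R := Coef (- (1 / 2)) (1 / 2) 0 0 0.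

Lemma admissible_dirx : admissible 0 dirx.
Proof. by split; rewrite /= ?oppr0. Qed.

Lemma admissible_diry : admissible 0 diry.
Proof. by split; rewrite /= ?oppr0. Qed.

Lemma upar_dirx x y z (h : R) : upar (x + h) y z = cadd h%:C (upar x y z) dirx.
Proof.
rewrite /upar /cadd/= !mulr0 !addr0.
have E s : (x + h) +i* s = (x +i* s) + h%:C :> C.
  by apply/eqP; rewrite eq_complex/= addr0 !eqxx.
by rewrite !E !mulrDr !(mulrC h%:C).
Qed.

Lemma upar_diry x y z (h : R) : upar x (y + h) z = cadd h%:C (upar x y z) diry.
Proof.
rewrite /upar /cadd/= !mulr0 !addr0.
rewrite !complexD !(rmorphN, rmorphD)/=; congr Coef.
- by apply: (i_ring (r := h%:C / 2)); field.
- by apply: (i_ring (r := - (h%:C / 2))); field.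
Qed.

(** A family that contains [E(x, y, 0)] and is closed under [dx] and [dy], which settles all partial
    derivatives at once. *)
Definition Fop l x y : C := kpi * opl l (mom0 (upar x y 0)) 0 0.

Lemma Fop_cderive_x l x y : is_cderive (fun s => Fop l s y) x (Fop (dirx :: l) x y).
Proof.
apply: qder_is_cderive; apply: qderZ.
under [X in qder X]eq_fun do rewrite upar_dirx.
apply: (opl_qder (M := fun h => mom0 (cadd h%:C (upar x y 0) dirx))) => j k.
exact: mom0_deriv (admissible_upar _ _ _) admissible_dirx.
Qed.

Lemma Fop_cderive_y l x y : is_cderive (fun s => Fop l x s) y (Fop (diry :: l) x y).
Proof.
apply: qder_is_cderive; apply: qderZ.
under [X in qder X]eq_fun do rewrite upar_diry.
apply: (opl_qder (M := fun h => mom0 (cadd h%:C (upar x y 0) diry))) => j k.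
exact: mom0_deriv (admissible_upar _ _ _) admissible_diry.
Qed.

Lemma is_cderive_cderive (g : R -> C) t (l : C) : is_cderive g t l -> cderive g t = l.
Proof.
move=> [h1 h2]; rewrite /cderive !derive1E.
have -> := @derive_val _ _ _ _ _ _ _ h1; have -> := @derive_val _ _ _ _ _ _ _ h2.
by case: l {h1 h2}.
Qed.

Lemma is_cderive_cderivable (g : R -> C) t (l : C) : is_cderive g t l -> cderivable g t.
Proof. by move=> [h1 h2]; split; [case: h1|case: h2]. Qed.

Lemma dx_Fop l : dx (Fop l) = Fop (dirx :: l).
Proof.
by apply/funext => x; apply/funext => y; exact: is_cderive_cderive (Fop_cderive_x l x y).
Qed.

Lemma dy_Fop l : dy (Fop l) = Fop (diry :: l).
Proof.
by apply/funext => x; apply/funext => y; exact: is_cderive_cderive (Fop_cderive_y l x y).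
Qed.

Lemma umbilicE_Fop : (fun x y => umbilicE x y 0) = Fop [::].
Proof. by apply/funext => x; apply/funext => y; rewrite umbilicE_mom0. Qed.

Lemma dword_Fop w : dword w (Fop [::]) =
  Fop [seq (if b : bool then dirx else diry) | b <- w].
Proof. by elim: w => [//|[] w IH] /=; rewrite IH ?dx_Fop ?dy_Fop. Qed.

Lemma has_all_partials_umbilicE : has_all_partials (fun x y => umbilicE x y 0).
Proof.
move=> w x y; rewrite umbilicE_Fop dword_Fop; split.
  exact: is_cderive_cderivable (Fop_cderive_x _ x y).
exact: is_cderive_cderivable (Fop_cderive_y _ x y).
Qed.

(* [quad (dirQ a b z)] is minus the quadratic form
   [(z - 3 a) xi^2 + 6 b xi eta + (z + 3 a) eta^2]. *)
Definition dirQ (a b z : R) : coef R :=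
  Coef 0 0 (3 / 2 * (a +i* b)) (3 / 2 * (a -i* b)) (- z%:C).

Lemma opl_lin3 (u v w : C) (m m1 m2 m3 : nat -> nat -> C) l j k :
  (forall j k, m j k = u * m1 j k + v * m2 j k + w * m3 j k) ->
  opl l m j k = u * opl l m1 j k + v * opl l m2 j k + w * opl l m3 j k.
Proof.
elim: l m m1 m2 m3 j k => [|y l IH] m m1 m2 m3 j k H; first exact: H.
by apply: IH => {}j {}k; rewrite /mulq !H; ring.
Qed.

(** Two derivatives multiply the integrand by products of [- i xi] and [- i eta], so the operator
    multiplies it by minus its quadratic symbol, which is [quad (dirQ a b z)]. *)
Lemma umbilic_op_Fop (z a b : R) l : umbilic_op z a b (Fop l) = Fop (dirQ a b z :: l).
Proof.
apply/funext => x; apply/funext => y.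
rewrite /umbilic_op !(dx_Fop, dy_Fop) /Fop /=.
set m := mom0 _.
rewrite [in RHS](@opl_lin3 (z - 3 * a)%:C (6 * b)%:C (z + 3 * a)%:C _
  (mulq dirx (mulq dirx m)) (mulq diry (mulq dirx m)) (mulq diry (mulq diry m))).
  by ring.
move: m => m j k.
have -> : mulq dirx (mulq dirx m) j k =
    - (1 / 4) * (m j.+2 k + 2 * m j.+1 k.+1 + m j k.+2).
  rewrite /mulq/= !mul0r !addr0.
  by apply: (i_ring (r := 1 / 4 * (m j.+2 k + 2 * m j.+1 k.+1 + m j k.+2))); field.
rewrite /mulq/= !mul0r !addr0 !complexD.
rewrite !(rmorphN, rmorphD, rmorphB, rmorphM) /=.
by field.
Qed.

Lemma iter_umbilic_op (z a b : R) n :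
  iter n (umbilic_op z a b) (fun x y => umbilicE x y 0) = Fop (nseq n (dirQ a b z)).
Proof.
by elim: n => [|n IH]; [exact: umbilicE_Fop|rewrite iterS IH umbilic_op_Fop].
Qed.

Lemma opl_nseq n (d : coef R) (m : nat -> nat -> C) : opl (nseq n d) m = iter n (mulq d) m.
Proof. by elim: n m => [//|n IH] m; rewrite iterSr -IH. Qed.

Lemma mulq_iter_cscale (h : C) (d : coef R) (m : nat -> nat -> C) n j k :
  iter n (mulq (cscale h d)) m j k = h ^+ n * iter n (mulq d) m j k.
Proof.
elim: n j k => [|n IH] j k; first by rewrite expr0 mul1r.
by rewrite !iterS mulq_cscale {1}/mulq !IH exprS /mulq; ring.
Qed.

(** The factor [i] turns the real form [quad (dirQ a b z)] into a purely imaginary one, as damping 0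
    requires. *)
Lemma admissible_dirQ (a b z : R) : admissible 0 (cscale 'i (dirQ a b z)).
Proof.
split; last by rewrite /= !(mul0r, mulr0, oppr0, subr0).
have h : 3 / 2 = (3 / 2 : R)%:C :> C by rewrite fmorph_div/= !rmorph_nat.
apply/eqP; rewrite /cscale /dirQ [cc _]/= [cd _]/= h eq_complex/=.
by apply/andP; split; apply/eqP; ring.
Qed.

(** With [i^n] absorbed into the direction, the partial sums are the Taylor polynomials of [mom0]
    along [i dirQ]; [growth_fact_small] sends the remainder of [mom0_taylor] to 0. *)
Lemma umbilic_series (x y z a b : R) :
  let u := x + 2 * a * z - 3 * (a ^+ 2 - b ^+ 2) in
  let v := y + 2 * b * z + 6 * a * b in
  series (umbilic_term x y z a b) n @[n --> \oo] -->
  (kpi * mom0 (cadd 1 (upar u v 0) (cscale 'i (dirQ a b z))) 0 0 : R[i]^o).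
Proof.
move=> u v; set y' := cscale _ _; set x' := upar u v 0.
have ax : admissible 0 x' := admissible_upar _ _ _.
have ay : admissible 0 y' := admissible_dirQ _ _ _.
have E n : series (umbilic_term x y z a b) n =
    kpi * \sum_(m < n) iter m (mulq y') (mom0 x') 0 0 / m`!%:R.
  rewrite /series/= big_mkord mulr_sumr; apply: eq_bigr => m _.
  rewrite /umbilic_term iter_umbilic_op -/u -/v /Fop opl_nseq mulq_iter_cscale.
  by rewrite -/x'; move: (iter _ _ _ _ _) ('i ^+ m) => I X; ring.
have [r [r0 xr]] := cbound_ex x'; have [s [s0 ys]] := cbound_ex y'.
have [N [N0 HN]] := mom0_taylor (r + s).
apply: cvgn_cmod => e e0.
set K := 5 + 4 * (r + s + 1).
have K1 : 1 <= K by rewrite /K; lra.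
have A0 : 0 <= cmod kpi * (2 * (5 * s) * N).
  by rewrite !mulr_ge0 ?cmod_ge0// ltW.
have B0 : 0 <= 5 * s by rewrite mulr_ge0 ?ltW.
have [M HM] := growth_fact_small A0 B0 K1 e0.
(* The Taylor polynomial of order [n] has [n.+1] terms, hence the shifted threshold. *)
exists M.+1 => -[//|n]; rewrite ltnS => /HM; apply: le_trans.
rewrite E -mulrBr cmodM -[cmod (_ - _)]cmodN opprB.
have := HN r s x' y' 0%N 0%N n ax ay xr ys (lexx _).
move=> /(ler_wpM2l (cmod_ge0 kpi)) h; apply: le_trans h _.
rewrite -/K addn0 addn0 mulnS (addnC 2).
rewrite le_eqVlt exprS; apply/orP; left; apply/eqP.
move: (growth K _) (cmod kpi) ((5 * s) ^+ n) => G k Z.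
by ring.
Qed.

End Umbilic.

(** * Translation of the plane by [(a, b)] *)

Section Translation.
Variable R : realType.
Local Notation C := R[i].
Implicit Types (x y z a b : R).

(** The value of the undamped phase at the point [(a, b)]. *)
Definition shift_const x y z a b : C :=
  - 'i * (a * x)%:C - 'i * (b * y)%:C - 'i * (z * (a ^+ 2 + b ^+ 2))%:C
  + 'i * (a ^+ 3 - 3 * a * b ^+ 2)%:C.

(** The cross term of [- |p + (a, b)|^2], which the translated damping contributes with weight
    [e]. *)
Definition dir_shift a b : coef R := Coef (- (a -i* b)) (- (a +i* b)) 0 0 0.

Lemma quad_dirQ a b z (p : R * R) : quad (cscale 'i (dirQ a b z)) p =
  'i * (3 * a * (p.1 ^+ 2 - p.2 ^+ 2) - 6 * b * p.1 * p.2
        - z * (p.1 ^+ 2 + p.2 ^+ 2))%:C.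
Proof.
have h : 3 / 2 = (3 / 2 : R)%:C :> C by rewrite fmorph_div/= !rmorph_nat.
case: p => u v; rewrite /quad /cscale /dirQ /= h /zeta /zetab/= !mulr0 !mul0r !add0r !expr2.
by apply/eqP; rewrite eq_complex/=; apply/andP; split; apply/eqP; field.
Qed.

Lemma quad_dir_shift a b (p : R * R) :
  quad (dir_shift a b) p = (- (2 * (a * p.1 + b * p.2)))%:C.
Proof.
case: p => u v; rewrite /quad /dir_shift /= /zeta /zetab/= !mul0r !addr0.
by apply/eqP; rewrite eq_complex/=; apply/andP; split; apply/eqP; ring.
Qed.

(** The exact Taylor expansion of the cubic phase at [(a, b)]: its linear part becomes that of
    [(u, v)], its quadratic part is [i dirQ], and its cubic part is unchanged. The damping leaves a
    constant and a linear term, both with a factor [e]. *)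
Lemma ph_reg_shift x y z a b (e : R) (p : R * R) :
  let u := x + 2 * a * z - 3 * (a ^+ 2 - b ^+ 2) in
  let v := y + 2 * b * z + 6 * a * b in
  ph (reg e (upar x y z)) (p.1 + a, p.2 + b) =
  (shift_const x y z a b - (e * (a ^+ 2 + b ^+ 2))%:C) +
  ph (cadd e%:C (reg e (cadd 1 (upar u v 0) (cscale 'i (dirQ a b z)))) (dir_shift a b)) p.
Proof.
move=> u v; rewrite ph_cadd reg_cadd ph_cadd !ph_reg_upar quad_dirQ quad_dir_shift.
rewrite /shift_const /u /v.
by apply/eqP; rewrite eq_complex/=; apply/andP; split; apply/eqP; ring.
Qed.

Lemma admissible_dir_shift a b : admissible 0 (dir_shift a b).
Proof. by split; rewrite /= ?oppr0. Qed.

Lemma mom_shift x y z a b (e : R) : 0 < e ->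
  let u := x + 2 * a * z - 3 * (a ^+ 2 - b ^+ 2) in
  let v := y + 2 * b * z + 6 * a * b in
  mom (reg e (upar x y z)) 0 0 =
  cexp (shift_const x y z a b - (e * (a ^+ 2 + b ^+ 2))%:C) *
  mom (cadd e%:C (reg e (cadd 1 (upar u v 0) (cscale 'i (dirQ a b z)))) (dir_shift a b)) 0 0.
Proof.
move=> e0 u v; set X' := cadd 1 _ _.
have aX : admissible e (reg e (upar x y z)) by apply/admissible_reg/admissible_upar.
have aX' : admissible e (cadd e%:C (reg e X') (dir_shift a b)).
  rewrite -[e in admissible e](addr0 e) -[X in _ + X](mulr0 e).
  apply: admissible_cadd (admissible_dir_shift a b); apply: admissible_reg.
  by apply: admissible0_cadd; [exact: admissible_upar|exact: admissible_dirQ].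
have [K pK] := phase_ph_ex e0 aX; have [K' pK'] := phase_ph_ex e0 aX'.
have e2 : 0 < e / 2 by rewrite divr_gt0.
rewrite /mom -(osc_translation a b e2 pK (tempered_mon R 0 0)).
rewrite -(oscZ _ e2 pK' (tempered_mon R 0 0)).
rewrite /osc; congr cintegral2; apply/funext => p.
by rewrite ph_reg_shift cexpD /mon !expr0 !mulr1 mul1r.
Qed.

(** By Taylor's formula of order 0, uniform in the damping, the linear perturbation [e d] changes
    the moment by a quantity of order [e]. *)
Lemma rlim_mom_dir_shift (x d : coef R) : admissible 0 x -> admissible 0 d ->
  rlim (fun e => mom (cadd e%:C (reg e x) d) 0 0) (mom0 x 0 0).
Proof.
move=> ax ad; have [r [r0 xr]] := cbound_ex x; have [s [s0 ds]] := cbound_ex d.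
have [N [N0 HN]] := mom_taylor (r + 1 + s).
apply: rlim_close (mom0P 0 0 ax) _ => e e01.
have /andP[e0 e1] := e01.
have ade : admissible 0 (cscale e%:C d).
  case: ad => k1 k2; split => /=; first by rewrite k1 conjcMr mulrN.
  by rewrite ReMr k2 oppr0 mulr0.
have des : cbound (e * s) (cscale e%:C d).
  case: ds => k1 k2 k3 k4 k5.
  by split => /=; rewrite cmodM cmod_real ger0_norm ?ler_wpM2l// ltW.
have e00 : 0 < e + 0 <= 1 by rewrite addr0.
have rr : r + 1 + e * s <= r + 1 + s by rewrite lerD2l ler_piMl// ltW.
have := HN e 0 (r + 1) (e * s) (reg e x) (cscale e%:C d) 0%N 0%N 0%N
  (admissible_reg e ax) ade e01 e00 (cbound_reg e01 xr) des rr.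
rewrite big_ord1/= fact0 !divr1 expr1.
have -> : cadd 1 (reg e x) (cscale e%:C d) = cadd e%:C (reg e x) d.
  by rewrite /cadd/= !mul1r.
move=> h; apply: le_trans h _.
rewrite (_ : 2 * _ = 2 * (5 * s * (N * growth (5 + 4 * (r + 1 + s)) (2 * 1 + (0 + 0)))) * e)//.
by move: (N * _) => G; ring.
Qed.

Lemma rlim_cexp_real (w : C) (k : R) : 0 <= k ->
  rlim (fun e => cexp (w - (e * k)%:C)) (cexp w).
Proof.
move=> k0; exists (cmod (cexp w) * k) => e /andP[e0 _].
rewrite cexpD -[X in _ - X]mulr1 -mulrBr cmodM -mulrA ler_wpM2l ?cmod_ge0//.
have -> : cexp (- (e * k)%:C) = (expR (- (e * k)))%:C.
  by rewrite /cexp/= oppr0 cos0 sin0 mulr1.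
rewrite -(rmorph1 (real_complex R)) -rmorphB/= cmod_real distrC ger0_norm.
  have := expR_ge1Dx (- (e * k)); rewrite mulrC; lra.
by rewrite subr_ge0 -expR0 ler_expR oppr_le0 mulr_ge0// ltW.
Qed.

Lemma mom0_shift x y z a b :
  let u := x + 2 * a * z - 3 * (a ^+ 2 - b ^+ 2) in
  let v := y + 2 * b * z + 6 * a * b in
  mom0 (upar x y z) 0 0 = cexp (shift_const x y z a b) *
    mom0 (cadd 1 (upar u v 0) (cscale 'i (dirQ a b z))) 0 0.
Proof.
move=> u v; apply: rlim_unique (mom0P 0 0 (admissible_upar x y z)) _.
have k0 : 0 <= a ^+ 2 + b ^+ 2 by rewrite addr_ge0 ?sqr_ge0.
have aX : admissible 0 (cadd 1 (upar u v 0) (cscale 'i (dirQ a b z))).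
  by apply: admissible0_cadd; [exact: admissible_upar|exact: admissible_dirQ].
(* For each [e] in the range the two sides agree exactly, hence [K := 0]. *)
apply: (rlim_close (K := 0) (rlimM (rlim_cexp_real (shift_const x y z a b) k0)
  (rlim_mom_dir_shift aX (admissible_dir_shift a b)))) => e /andP[e0 _].
by rewrite (mom_shift _ _ _ a b e0) subrr cmod0 mul0r.
Qed.

End Translation.

(* The first two conjuncts say that the objects in the identity are well
   defined: the limit defining the integral exists, and the function being
   differentiated has partial derivatives of every order. *)
Theorem mainTheorem7 (R : realType) :
  [/\ forall x y z : R, cvg (umbilic_reg x y z eps @[eps --> 0^'+]),
      has_all_partials (fun x y : R => umbilicE x y 0)
    & forall x y z a b : R,
        cvgn (series (umbilic_term x y z a b)) /\
        umbilicE x y z =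
          cexp (- 'i * (a * x)%:C - 'i * (b * y)%:C
                - 'i * (z * (a ^+ 2 + b ^+ 2))%:C
                + 'i * (a ^+ 3 - 3 * a * b ^+ 2)%:C)
          * limn (series (umbilic_term x y z a b))].
Proof.
split=> [x y z||x y z a b].
- by apply: cvgP; exact: umbilic_reg_cvg.
- exact: has_all_partials_umbilicE.
- have h := @umbilic_series R x y z a b; split; first exact: cvgP h.
  rewrite (cvg_lim (@norm_hausdorff R[i] R[i]^o) h) umbilicE_mom0 (mom0_shift x y z a b).
  by rewrite mulrCA.
Qed.
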